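(* Let $\Sigma$ be a standard SLDS with modes $\ker R_1(\frac{d}{dt})$, $\ker R_2(\frac{d}{dt})$, where $R_1,R_2\in\mathbb{R}^{\tt w\times\tt w}[\xi]$ are Hurwitz and $R_2R_1^{-1}$ is strictly proper and strictly positive-real. Define $\Phi(\zeta,\eta):=R_1(\zeta)^\top R_2(\eta)+R_2(\zeta)^\top R_1(\eta)$. Then there exists $Q\in\mathbb{R}^{\bullet\times\tt w}[\xi]$ such that $\Phi(-\xi,\xi)=Q(-\xi)^\top Q(\xi)$, $\operatorname{rank}\begin{bmatrix}R_1(\lambda)\\Q(\lambda)\end{bmatrix}=\tt w$ for all $\lambda\in\mathbb{C}$, and $QR_1^{-1}$ is strictly proper. Define $$\Psi_1(\zeta,\eta):=\frac{\Phi(\zeta,\eta)-Q(\zeta)^\top Q(\eta)}{\zeta+\eta}.$$ Then $\Psi_1$ is $R_1$-canonical. Moreover, with $\Psi_2:=\Psi_1\bmod R_2$, the pair $\{\Psi_1,\Psi_2\}$ induces a multiple Lyapunov function for $\Sigma$.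
   Context: Standard SLDS: let $R_1,R_2\in\mathbb{R}^{\tt w\times\tt w}[\xi]$ be nonsingular with $R_2R_1^{-1}$ strictly proper, $n_j=\deg\det R_j$. Let $X_2\in\mathbb{R}^{n_2\times\tt w}[\xi]$, $X_1'\in\mathbb{R}^{(n_1-n_2)\times\tt w}[\xi]$, $\Pi\in\mathbb{R}^{(n_1-n_2)\times n_2}$ be such that the rows of $X_2$ form a basis of $\{f\in\mathbb{R}^{1\times\tt w}[\xi]: fR_2^{-1}\text{ strictly proper}\}$ (a minimal state map for $\mathfrak{B}_2=\ker R_2(\frac{d}{dt})$), the rows of $X_1:=\mathrm{col}(X_2,X_1')$ form a basis of $\{f: fR_1^{-1}\text{ strictly proper}\}$ (a minimal state map for $\mathfrak{B}_1=\ker R_1(\frac{d}{dt})$), and $X_1'\bmod R_2=\Pi X_2$. Here, for nonsingular $R$ and polynomial row $f$, $fR^{-1}=s+p$ with $s$ strictly proper, $p$ polynomial, and $f\bmod R:=sR$ (rowwise); for $\Psi(\zeta,\eta)=M(\zeta)^\top L(\eta)$, $\Psi\bmod R:=(M\bmod R)(\zeta)^\top(L\bmod R)(\eta)$, and $\Psi$ is $R$-canonical if $\Psi=\Psi\bmod R$. The standard SLDS is the switched system with modes $\mathfrak{B}_1,\mathfrak{B}_2$, switching signals piecewise constant right-continuous $s:\mathbb{R}\to\{1,2\}$ with finitely many switches in bounded intervals, and gluing conditions $(G^-_{2\to1},G^+_{2\to1})=(\mathrm{col}(X_2,\Pi X_2),\mathrm{col}(X_2,X_1'))$, $(G^-_{1\to2},G^+_{1\to2})=(X_2,X_2)$;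 its trajectories $w$ are those which on each interval between consecutive switching instants $t_i$ coincide with a trajectory of the active mode and satisfy $G^+_{k\to\ell}(\frac{d}{dt})w(t_i^+)=G^-_{k\to\ell}(\frac{d}{dt})w(t_i^-)$ at each switch from mode $k$ to mode $\ell$. Hurwitz: determinant has all roots in the open left half-plane. $G$ rational is strictly positive-real if analytic in $\mathbb{C}_+$ and $G(-j\omega)^\top+G(j\omega)>0$ for all real $\omega$. QDF: $\Psi(\zeta,\eta)=\sum\Psi_{h,k}\zeta^h\eta^k$ induces $Q_\Psi(w)=\sum(\frac{d^hw}{dt^h})^\top\Psi_{h,k}\frac{d^kw}{dt^k}$. $\{\Psi_1,\Psi_2\}$ induces a multiple Lyapunov function if $Q_{\Psi_i}\ge0$ along $\mathfrak{B}_i$, $\frac{d}{dt}Q_{\Psi_i}$ (induced by $(\zeta+\eta)\Psi_i$) is negative along $\mathfrak{B}_i$ (nonpositive, zero only for $w=0$), and at every switching instant $t_j$ of every admissible trajectory $w$, $Q_{\Psi_{s(t_{j-1})}}(w)(t_j^-)\ge Q_{\Psi_{s(t_j)}}(w)(t_j^+)$. *)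

(* Defs.v *)
From HB Require Import structures.
From mathcomp Require Import all_boot all_order all_algebra.
From mathcomp Require Import all_classical all_reals all_analysis.
From mathcomp.real_closed Require Import complex.
Set Implicit Arguments.
Unset Strict Implicit.
Unset Printing Implicit Defensive.
Import Order.TTheory GRing.Theory Num.Theory.
Local Open Scope ring_scope.

Section SLDSDefs.
Variable R : realType.

(* F R^{-1} is strictly proper.  Since F R^{-1} = F adj(R) / det R, each
   entry is the rational function (F adj R)_ij / det R, which is strictly
   proper iff its numerator has smaller degree than its denominator. *)
Definition sp_right {m n : nat} (F : 'M[{poly R}]_(m, n))
  (P : 'M[{poly R}]_n) : Prop :=
  forall i j, (size ((F *m \adj P) i j) < size (\det P))%N.

(* f mod P := s P where f P^{-1} = s + p, s strictly proper, p polynomial.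
   The polynomial part p of f P^{-1} = f adj(P)/det P is obtained entrywise
   by Euclidean division by det P; then s P = f - p P.  (rowwise) *)
Definition rmod {m n : nat} (P : 'M[{poly R}]_n) (F : 'M[{poly R}]_(m, n))
  : 'M[{poly R}]_(m, n) :=
  F - map_mx (fun e => e %/ \det P) (F *m \adj P) *m P.

Definition state_basis {p n : nat} (P : 'M[{poly R}]_n)
  (X : 'M[{poly R}]_(p, n)) : Prop :=
  sp_right X P /\
  (forall c : 'rV[R]_p, map_mx polyC c *m X = 0 -> c = 0) /\
  (forall f : 'rV[{poly R}]_n, sp_right f P ->
     exists c : 'rV[R]_p, f = map_mx polyC c *m X).

(* A two-variable polynomial is an element of {poly {poly R}}: the     *)
(* OUTER variable is zeta, the INNER one is eta, so that the           *)
(* coefficient of zeta^h eta^k in p is  p`_h`_k.                        *)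

Definition bilin {p n : nat} (M L : 'M[{poly R}]_(p, n))
  : 'M[{poly {poly R}}]_n :=
  \matrix_(i, j) \sum_(r < p) map_poly polyC (M r i) * (L r j)%:P.

Definition zeta_plus_eta : {poly {poly R}} := 'X + ('X)%:P.

Definition mul_zpe {n : nat} (Psi : 'M[{poly {poly R}}]_n)
  : 'M[{poly {poly R}}]_n :=
  map_mx (fun p => zeta_plus_eta * p) Psi.

Definition diag_sub {n : nat} (Psi : 'M[{poly {poly R}}]_n)
  : 'M[{poly R}]_n :=
  map_mx (fun p => p.[- 'X]) Psi.

Definition qdf_mod {n : nat} (P : 'M[{poly R}]_n)
  (Psi Psi' : 'M[{poly {poly R}}]_n) : Prop :=
  exists p (M L : 'M[{poly R}]_(p, n)),
    Psi = bilin M L /\ Psi' = bilin (rmod P M) (rmod P L).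

Definition r_canonical {n : nat} (P : 'M[{poly R}]_n)
  (Psi : 'M[{poly {poly R}}]_n) : Prop :=
  qdf_mod P Psi Psi.

Definition evalC (p : {poly R}) (z : R[i]) : R[i] :=
  (map_poly (real_complex R) p).[z].

Definition evalCmx {m n : nat} (P : 'M[{poly R}]_(m, n)) (z : R[i])
  : 'M[R[i]]_(m, n) := map_mx (fun p => evalC p z) P.

Definition hurwitz {n : nat} (P : 'M[{poly R}]_n) : Prop :=
  forall z : R[i], root (map_poly (real_complex R) (\det P)) z ->
    complex.Re z < 0.

Definition rat_eval {m n : nat} (N : 'M[{poly R}]_(m, n)) (d : {poly R})
  (z : R[i]) : 'M[R[i]]_(m, n) :=
  map_mx (fun p => evalC p z / evalC d z) N.

Definition analytic_at {m n : nat} (N : 'M[{poly R}]_(m, n)) (d : {poly R})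
  (z : R[i]) : Prop :=
  forall i j, exists n' d' : {poly R},
    N i j * d' = n' * d /\ evalC d' z != 0.

(* Hermitian positive definiteness: v^* H v is real and > 0 for v <> 0
   (in the order of R[i], 0 < z means z is real and positive). *)
Definition posdef {n : nat} (H : 'M[R[i]]_n) : Prop :=
  forall v : 'cV[R[i]]_n, v != 0 ->
    0 < ((map_mx conjc v)^T *m H *m v) ord0 ord0.

Definition strictly_positive_real {n : nat} (N : 'M[{poly R}]_n)
  (d : {poly R}) : Prop :=
  (forall z : R[i], 0 < complex.Re z -> analytic_at N d z) /\
  (forall w : R, posdef ((rat_eval N d (Complex 0 (- w)))^T
                          + rat_eval N d (Complex 0 w))).

Definition traj (n : nat) := 'I_n -> R -> R.

Definition smooth (f : R -> R) : Prop :=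
  forall (k : nat) (x : R), derivable (derive1n k f) x 1.

Definition diffop {m n : nat} (P : 'M[{poly R}]_(m, n)) (v : traj n)
  : traj m :=
  fun i t => \sum_(j < n) \sum_(k < size (P i j))
               (P i j)`_k * derive1n k (v j) t.

Definition in_beh {m n : nat} (P : 'M[{poly R}]_(m, n)) (v : traj n) : Prop :=
  (forall j, smooth (v j)) /\ (forall i t, diffop P v i t = 0).

Definition qdf {n : nat} (Psi : 'M[{poly {poly R}}]_n) (v : traj n)
  : R -> R :=
  fun t => \sum_(i < n) \sum_(j < n)
     \sum_(h < size (Psi i j)) \sum_(k < size ((Psi i j)`_h))
        (Psi i j)`_h`_k * derive1n h (v i) t * derive1n k (v j) t.

Inductive mode := Mode1 | Mode2.

Definition convex_set (I : set R) : Prop :=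
  forall x y z, I x -> I z -> x <= y -> y <= z -> I y.

Definition switch_at (s : R -> mode) (t : R) : Prop :=
  forall e, 0 < e -> exists t', t - e < t' /\ t' < t /\ s t' <> s t.

Definition admissible_signal (s : R -> mode) : Prop :=
  (forall t, exists2 e, 0 < e & forall t', t <= t' -> t' < t + e -> s t' = s t)
  /\ (forall t, exists2 e, 0 < e & forall t' t'',
        t - e < t' -> t' < t -> t - e < t'' -> t'' < t -> s t' = s t'')
  /\ (forall a b : R, finite_set [set t | a <= t /\ t <= b /\ switch_at s t]).

Definition agree_on {n : nat} (I : set R) (w v : traj n) : Prop :=
  forall t, I t -> forall j, w j t = v j t.

Section Switched.
Variables (n g21 g12 : nat).
Variable Pm : mode -> 'M[{poly R}]_n.
Variables (G21m G21p : 'M[{poly R}]_(g21, n)) (G12m G12p : 'M[{poly R}]_(g12, n)).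

(* G^+_{k->l}(d/dt) w(t^+) = G^-_{k->l}(d/dt) w(t^-), where w = vm on the
   left of t and w = vp on the right of t *)
Definition glue (k l : mode) (vm vp : traj n) (t : R) : Prop :=
  match k, l with
  | Mode2, Mode1 => forall i, diffop G21p vp i t = diffop G21m vm i t
  | Mode1, Mode2 => forall i, diffop G12p vp i t = diffop G12m vm i t
  | _, _ => True
  end.

Definition switch_pieces (s : R -> mode) (w : traj n) (t : R) (k l : mode)
  (vm vp : traj n) : Prop :=
  switch_at s t /\ s t = l /\
  exists2 e, 0 < e &
    (forall t', t - e < t' -> t' < t -> s t' = k) /\
    in_beh (Pm k) vm /\ in_beh (Pm l) vp /\
    agree_on [set t' | t - e < t' /\ t' < t] w vm /\
    agree_on [set t' | t <= t' /\ t' < t + e] w vp.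

Definition admissible_traj (s : R -> mode) (w : traj n) : Prop :=
  admissible_signal s /\
  (* on each interval between consecutive switching instants, w coincides
     with a trajectory of the active mode *)
  (forall I : set R, convex_set I ->
     (forall t, I t -> switch_at s t -> forall t', I t' -> t <= t') ->
     forall t0, I t0 ->
       exists v, in_beh (Pm (s t0)) v /\ agree_on I w v) /\
  (forall t k l vm vp, switch_pieces s w t k l vm vp -> glue k l vm vp t).

Definition multiple_lyapunov (Psi : mode -> 'M[{poly {poly R}}]_n) : Prop :=
  (forall k v, in_beh (Pm k) v -> forall t, 0 <= qdf (Psi k) v t) /\
  (forall k v, in_beh (Pm k) v ->
     (forall t, qdf (mul_zpe (Psi k)) v t <= 0) /\
     ((forall t, qdf (mul_zpe (Psi k)) v t = 0) -> forall j t, v j t = 0)) /\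
  (forall s w, admissible_traj s w ->
     forall t k l vm vp, switch_pieces s w t k l vm vp ->
       qdf (Psi l) vp t <= qdf (Psi k) vm t).

End Switched.

End SLDSDefs.

(* Main.v *)
Require Import Defs.
From HB Require Import structures.
From mathcomp Require Import all_boot all_order all_algebra.
From mathcomp Require Import all_classical all_reals all_analysis.
From mathcomp.real_closed Require Import complex.
From mathcomp Require Import perm zify ring.
Set Implicit Arguments.
Unset Strict Implicit.
Unset Printing Implicit Defensive.
Import Order.TTheory GRing.Theory Num.Theory.
Local Open Scope ring_scope.

(** Factorization.  Writing [p~(xi)] for the paraconjugate of [p], the form
    [H = R1~ R2 + R2~ R1] is positive definite on the imaginary axis.  Reducing a
    complex positive definite polynomial form step by step, splitting off the roots
    of its determinant in the open right half plane, yields [H = Q~ Q] with [Q]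
    complex and invertible on the closed left half plane; stacking the real and
    imaginary parts of [Q] gives a real factor, right coprime with [R1] because [R1]
    is Hurwitz.

    Storage function.  Multiplication by [xi] acts on the state map [X1] by
    [xi X1 = A X1 + B R1], where [A] inherits its spectrum from [det R1].  If
    [Q = G X1], the Lyapunov equation [A^T K + K A = - G^T G] has a unique solution
    [K], which is positive semidefinite, and [R2 = B^T K X1] since a strictly proper
    function equal to minus its paraconjugate and with poles in one half plane is
    zero.  Hence [Psi1 = X1^T K X1], and the derivative of its quadratic form is
    [- |Q(d/dt) w|^2] along either mode.

    Switching.  [C B = B^T K B] is invertible, so [det R2] has degree
    [deg det R1 - n] and the block of [B] belonging to [X1'] is onto, while the block
    belonging to [X2] is zero.  Since [K B = C^T] and [C] vanishes on
    [col(1, Pi)], the states [(a, Pi a)] and [(0, y)] are [K]-orthogonal, and the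
    reset to [(a, Pi a)] cannot increase the form. *)

(** * Top coefficients and degree bounds of polynomial matrices *)

Lemma coef_mul_top (R : nzRingType) (p q : {poly R}) m n :
  (size p <= m.+1)%N -> (size q <= n.+1)%N -> (p * q)`_(m + n) = p`_m * q`_n.
Proof.
move=> sp sq; rewrite coefM (bigD1 (inord m)) //= inordK; last by rewrite ltnS leq_addr.
rewrite addKn big1 ?addr0 // => j /eqP jN.
have [lt_mj|le_jm] := ltnP m j; first by rewrite [p`_j]nth_default ?mul0r // (leq_trans sp).
rewrite [q`_ _]nth_default ?mulr0 //; apply: (leq_trans sq).
have : (val j != m).
  by apply/eqP => h; apply: jN; apply/val_inj; rewrite /= inordK // ltnS leq_addr.
by move: le_jm => /=; lia.
Qed.

Lemma coef_prod_top (R : comNzRingType) (I : finType) (F : I -> {poly R}) (e : I -> nat) :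
  (forall i, size (F i) <= (e i).+1)%N ->
  (\prod_i F i)`_(\sum_i e i) = \prod_i (F i)`_(e i).
Proof.
move=> sF.
suff: (size (\prod_i F i)%R <= (\sum_i e i).+1)%N /\
      (\prod_i F i)`_(\sum_i e i) = \prod_i (F i)`_(e i) by case.
elim/big_rec3: _ => [|i c d p _ [sp cp]]; first by rewrite size_poly1 coef1.
split; last by rewrite coef_mul_top // cp.
by apply: (leq_trans (size_polyMleq _ _)); move: (sF i); lia.
Qed.

(** Each term of the expansion takes one entry per row and per column, so its weight is always the
    sum of all [a i] and [b i]; the coefficient in that degree sees only the top coefficients of the
    entries. *)
Lemma coef_det_top (R : comNzRingType) n (H : 'M[{poly R}]_n) (a b : 'I_n -> nat) :
  (forall i j, size (H i j) <= (a i + b j).+1)%N ->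
  (\det H)`_(\sum_i a i + \sum_i b i) =
  \det (\matrix_(i, j) (H i j)`_(a i + b j)).
Proof.
move=> sH; rewrite /determinant coef_sum; apply: eq_bigr => s _.
have -> : (\sum_i a i + \sum_i b i = \sum_i (a i + b (s i)))%N.
  by rewrite big_split /= [X in (_ + X)%N](reindex_inj (@perm_inj _ s)).
under [in RHS]eq_bigr do rewrite mxE.
rewrite -(coef_prod_top (F := fun i => H i (s i))) //.
by case: (odd_perm s); rewrite ?expr0 ?expr1 ?mul1r ?mulN1r ?coefN.
Qed.

Lemma coef_compN (R : comNzRingType) (q : {poly R}) k :
  (q \Po (- 'X))`_k = (-1) ^+ k * q`_k.
Proof.
elim/poly_ind: q k => [|q c IH] k; first by rewrite comp_poly0 coef0 mulr0.
rewrite comp_polyD comp_polyM comp_polyX comp_polyC mulrN !(coefD, coefN, coefC).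
rewrite !coefMX; case: k => [|k] /=; first by rewrite oppr0 expr0 mul1r.
by rewrite IH exprS mulN1r !addr0 mulNr.
Qed.

Lemma mulmxI_det (R : idomainType) m n (M : 'M[R]_(m, n)) (S : 'M[R]_n) :
  \det S != 0 -> M *m S = 0 -> M = 0.
Proof.
move=> dS /(congr1 (mulmx^~ (\adj S))); rewrite -mulmxA mul_mx_adj mul0mx mul_mx_scalar.
move/matrixP=> e; apply/matrixP=> i j; move: (e i j); rewrite !mxE => /eqP.
by rewrite mulf_eq0 (negPf dS) => /eqP.
Qed.

Lemma size_mulmx_leq (R : nzRingType) m n p (M : 'M[{poly R}]_(m, n))
    (P : 'M[{poly R}]_(n, p)) i l N :
  (forall j, size (M i j * P j l)%R <= N)%N -> (size ((M *m P) i l)%R <= N)%N.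
Proof.
move=> h; rewrite mxE; apply: (leq_trans (size_sum _ _ _)).
by apply/bigmax_leqP => j _; apply: h.
Qed.

Lemma leq_size_coef0 (R : nzRingType) (p : {poly R}) N :
  (size p <= N.+1)%N -> p`_N = 0 -> (size p <= N)%N.
Proof.
move=> sp p0; apply/leq_sizeP => j; rewrite leq_eqVlt => /orP[/eqP <-//|lt].
by rewrite nth_default // (leq_trans sp).
Qed.

(** Normalises a kernel vector to have entry 1 at an index [k] of largest weight in its support, so
    that adding the other columns to column [k] respects the weights. *)
Lemma max_pivot (F : fieldType) n (a : 'I_n -> nat) (v : 'cV[F]_n) : v != 0 ->
  exists (k : 'I_n) (s : F), (s *: v) k 0 = 1 /\
    forall j, (s *: v) j 0 != 0 -> (a j <= a k)%N.
Proof.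
move=> nz; have [k0 k0P] : exists k, v k 0 != 0.
  apply/existsP; apply: contraNT nz; rewrite negb_exists => /forallP h.
  apply/eqP/matrixP=> i j; rewrite ord1 mxE; apply/eqP.
  by have := h i; rewrite negbK.
pose k := [arg max_(k > k0 | v k 0 != 0) a k].
exists k, (v k 0)^-1; rewrite /k; case: arg_maxnP => // i vi imax.
split; first by rewrite mxE mulVf.
by move=> j; rewrite mxE mulf_eq0 negb_or => /andP[_ /imax].
Qed.

(** * Elementary column operations *)

Section ColumnReplacement.
Variables (R : comNzRingType) (n : nat) (k : 'I_n).

Definition replace_col (c : 'cV[R]_n) : 'M[R]_n :=
  \matrix_(i, j) if j == k then c i 0 else (i == j)%:R.

Lemma mulmx_replace_col m (M : 'M[R]_(m, n)) (c : 'cV[R]_n) i j :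
  (M *m replace_col c) i j = if j == k then (M *m c) i 0 else M i j.
Proof.
rewrite !mxE; case: eqP => [->|/eqP nk].
  by apply: eq_bigr => l _; rewrite !mxE eqxx.
rewrite (bigD1 j) //= mxE (negPf nk) eqxx mulr1 big1 ?addr0 // => l nl.
by rewrite mxE (negPf nk) (negPf nl) mulr0.
Qed.

(** [delta_mx k 0 *+ 2 - c] is [c] with the entries off the pivot negated, which undoes the
    operation. *)
Lemma replace_col_mulV (c : 'cV[R]_n) : c k 0 = 1 ->
  replace_col c *m replace_col (delta_mx k 0 *+ 2 - c) = 1%:M.
Proof.
move=> ck; apply/matrixP=> i j; rewrite mulmx_replace_col.
case: eqP => [->|/eqP nk]; last by rewrite !mxE (negPf nk).
rewrite mulr2n mulmxBr mulmxDr -colE !mxE eqxx (bigD1 k) //= !mxE eqxx ck mulr1.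
have [->|nik] := eqVneq i k.
  rewrite big1 ?addr0 ?ck ?addrK // => l nl.
  by rewrite !mxE (negPf nl) eq_sym (negPf nl) mul0r.
rewrite (bigD1 i) //= !mxE (negPf nik) eqxx mul1r big1 ?addr0 ?subrr //.
by move=> l /andP[nl nli]; rewrite !mxE (negPf nl) eq_sym (negPf nli) mul0r.
Qed.
End ColumnReplacement.

Lemma kernel_vector (F : fieldType) n (M : 'M[F]_n) : \det M = 0 ->
  exists2 v : 'cV[F]_n, v != 0 & M *m v = 0.
Proof.
rewrite -det_tr => /eqP/det0P[v nz e]; exists v^T.
  by apply: contraNneq nz => /(congr1 trmx); rewrite trmxK trmx0 => ->.
by rewrite -[M]trmxK -trmx_mul e trmx0.
Qed.

Lemma replace_col_unit (F : comUnitRingType) n (k : 'I_n) (c : 'cV[F]_n) : c k 0 = 1 ->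
  replace_col k c \in unitmx.
Proof. by move/replace_col_mulV/mulmx1_unit; case. Qed.

Lemma sum_decr n (a : 'I_n -> nat) k : (0 < a k)%N ->
  (\sum_i (if i == k then (a k).-1 else a i) < \sum_i a i)%N.
Proof.
move=> ak; rewrite (bigD1 k) //= eqxx [X in (_ < X)%N](bigD1 k) //=.
rewrite (eq_bigr a); last by move=> i /negPf ->.
by rewrite -addSn prednK.
Qed.

Lemma size_mul_bound (R : nzRingType) (p q : {poly R}) x y N :
  (size p <= x -> size q <= y.+1 -> x + y <= N -> size (p * q)%R <= N)%N.
Proof. by move=> *; apply: (leq_trans (size_polyMleq _ _)); lia. Qed.

Section Hermitian.
Variable C : numClosedFieldType.
Local Notation ev z := (map_mx (horner_eval z)).

(** * Positive definite forms over the polynomials *)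

(** The paraconjugate: its value at [z] is the conjugate of the value at [- z^*], so on the
    imaginary axis it conjugates values. *)
Definition parac (p : {poly C}) : {poly C} := map_poly Num.conj p \Po (- 'X).
HB.instance Definition _ := GRing.RMorphism.copy parac
  (comp_poly (- 'X) \o map_poly (@Num.conj C)).

Lemma coef_parac p k : (parac p)`_k = (-1) ^+ k * (p`_k)^*.
Proof. by rewrite /parac coef_compN coef_map. Qed.

Lemma paracK : involutive parac.
Proof.
by move=> p; apply/polyP=> k; rewrite !coef_parac rmorphM rmorphXn rmorphN1 /=
  conjCK mulrA -exprMn mulrNN mulr1 expr1n mul1r.
Qed.

Lemma size_parac p : size (parac p) = size p.
Proof.
suff le q : (size (parac q) <= size q)%N.
  by apply/eqP; rewrite eqn_leq le -{1}[p]paracK le.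
by apply/leq_sizeP => j /(nth_default 0) e; rewrite coef_parac e rmorph0 mulr0.
Qed.

Lemma horner_parac p z : (parac p).[z] = (p.[- z^*])^*.
Proof.
rewrite /parac horner_comp hornerN hornerX -{1}[z]conjCK -rmorphN.
by rewrite horner_map.
Qed.

Lemma paracXsubC l : parac ('X - l%:P) = - ('X - (- l^*)%:P).
Proof.
apply/polyP=> k; rewrite coef_parac !(coefN, coefB, coefX, coefC).
by case: k => [|[|k]] /=; rewrite ?expr0 ?expr1 ?mul1r ?subr0 ?sub0r ?rmorphN
   ?rmorph1 ?opprK ?mulr1 ?rmorph0 ?mulr0 ?oppr0.
Qed.

Definition parah m n (M : 'M[{poly C}]_(m, n)) : 'M[{poly C}]_(n, m) :=
  (map_mx parac M)^T.

Lemma parahE m n (M : 'M[{poly C}]_(m, n)) i j : parah M i j = parac (M j i).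
Proof. by rewrite !mxE. Qed.

Lemma parahM m n p (M : 'M[{poly C}]_(m, n)) (N : 'M[{poly C}]_(n, p)) :
  parah (M *m N) = parah N *m parah M.
Proof. by rewrite /parah map_mxM trmx_mul. Qed.

Lemma parahK m n (M : 'M[{poly C}]_(m, n)) : parah (parah M) = M.
Proof. by apply/matrixP=> i j; rewrite !parahE paracK. Qed.

Definition hadj m n (M : 'M[C]_(m, n)) : 'M[C]_(n, m) := (map_mx Num.conj M)^T.

Lemma hadjM m n p (M : 'M[C]_(m, n)) (N : 'M[C]_(n, p)) :
  hadj (M *m N) = hadj N *m hadj M.
Proof. by rewrite /hadj map_mxM trmx_mul. Qed.

Lemma hadjK m n (M : 'M[C]_(m, n)) : hadj (hadj M) = M.
Proof. by apply/matrixP=> i j; rewrite !mxE conjCK. Qed.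

Lemma eval_parah m n (M : 'M[{poly C}]_(m, n)) z :
  ev z (parah M) = hadj (ev (- z^*) M).
Proof. by apply/matrixP=> i j; rewrite !mxE /horner_eval horner_parac. Qed.

Lemma eval_parah_axis m n (M : 'M[{poly C}]_(m, n)) z : z + z^* = 0 ->
  ev z (parah M) = hadj (ev z M).
Proof. by move/eqP; rewrite addr_eq0 => /eqP e; rewrite eval_parah -e. Qed.

Definition posdefC n (H : 'M[C]_n) : Prop :=
  forall v : 'cV[C]_n, v != 0 -> 0 < (hadj v *m H *m v) 0 0.

Lemma posdefC_unit n (H : 'M[C]_n) : posdefC H -> H \in unitmx.
Proof.
move=> pH; rewrite -unitmx_tr -row_free_unit -kermx_eq0.
apply/eqP/row_matrixP => i; rewrite row0; apply/eqP/negPn/negP => nz.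
set v := row i _ in nz.
have vH : v *m H^T = 0 by apply/sub_kermxP; exact: row_sub.
have /pH : v^T != 0 by apply: contraNneq nz => /(congr1 trmx); rewrite trmxK trmx0 => ->.
by rewrite -mulmxA -{1}[H]trmxK -trmx_mul vH trmx0 mulmx0 mxE ltxx.
Qed.

Lemma posdefC_congr m n (H : 'M[C]_n) (S : 'M[C]_(n, m)) :
  (forall v : 'cV[C]_m, S *m v = 0 -> v = 0) -> posdefC H -> posdefC (hadj S *m H *m S).
Proof.
move=> iS pH v nz.
have /pH : S *m v != 0 by apply: contraNneq nz => /iS ->.
by rewrite hadjM !mulmxA.
Qed.

(** Roots off the axis come in distinct pairs [l], [- l^*], so the degree is even. Splitting off one
    pair leaves a polynomial of the same kind. *)
Lemma odd_size_axis p : p != 0 -> parac p = p ->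
  (forall z, z + z^* = 0 -> ~~ root p z) -> odd (size p).
Proof.
move: {2}(size p) (leqnn (size p)) => N; elim: N p => [|N IH] p.
  by rewrite leqn0 size_poly_eq0 => /eqP ->; rewrite eqxx.
move=> sN nz hp nr; have [s1|ns1] := eqVneq (size p) 1%N; first by rewrite s1.
have /closed_rootP[l rl] := ns1.
have rl' : root p (- l^*).
  by rewrite /root -hp horner_parac rmorphN /= conjCK opprK (rootP rl) conjC0.
have nl : - l^* != l.
  apply/eqP => e; have hl : l + l^* = 0 by rewrite -{1}e addNr.
  by move: (nr l hl); rewrite rl.
have /factor_theorem[q e] := rl.
have : root q (- l^*).
  by move: rl'; rewrite e rootM root_XsubC (negPf nl) orbF.
case/factor_theorem => r e2.
have ep : p = (- r) * parac ('X - l%:P) * ('X - l%:P).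
  by rewrite paracXsubC mulrNN e e2.
have rnz : - r != 0 by apply: contraNneq nz => r0; rewrite ep r0 !mul0r.
have tnz : parac ('X - l%:P) != 0.
  by rewrite -size_poly_eq0 size_parac size_XsubC.
have sz : size p = (size (- r)).+2.
  by rewrite ep !size_mul ?mulf_neq0 ?polyXsubC_eq0 // size_parac size_XsubC !addn2.
rewrite sz /= negbK; apply: IH => //; first by move: sN; rewrite sz ltnS => /ltnW.
  (* The split-off factor equals its own paraconjugate, so cancelling it transfers the symmetry to
     the cofactor. *)
  have dnz : parac ('X - l%:P) * ('X - l%:P) != 0 by rewrite mulf_neq0 // polyXsubC_eq0.
  apply: (mulIf dnz); rewrite [RHS]mulrA -ep -[RHS]hp ep 2!rmorphM /= paracK.
  by rewrite -mulrA [_ * parac _]mulrC.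
by move=> z hz; apply: contra (nr z hz) => rz; rewrite ep !rootM rz.
Qed.

(** [z + z^*] is twice the real part: [Q] must be invertible on the closed left half plane, the side
    where the zeros of a Hurwitz [R1] lie. *)
Definition has_spectral_factor n (H : 'M[{poly C}]_n) :=
  exists Q : 'M[{poly C}]_n, H = parah Q *m Q /\
    forall z, z + z^* <= 0 -> ev z Q \in unitmx.

Definition axis_posdef n (H : 'M[{poly C}]_n) :=
  forall z, z + z^* = 0 -> posdefC (ev z H).

Lemma axis_posdef_diag n (H : 'M[{poly C}]_n) k : axis_posdef H ->
  forall z, z + z^* = 0 -> ~~ root (H k k) z.
Proof.
move=> pH z hz; have nz : delta_mx k 0 != 0 :> 'cV[C]_n.
  by apply/eqP => /matrixP/(_ k 0) /eqP; rewrite !mxE !eqxx oner_eq0.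
have := pH z hz _ nz; rewrite -mulmxA -colE.
have -> : hadj (delta_mx k 0) = delta_mx 0 k :> 'rV[C]_n.
  by apply/matrixP=> i j; rewrite !mxE rmorph_nat andbC.
by rewrite -rowE !mxE /root => /lt0r_neq0.
Qed.

(** A factor [Q] of the reduced form gives the factor [Q *m S]. The reduced form inherits symmetry
    by cancelling [S], nonsingular because invertible at 0, and positivity because [S] is invertible
    on the axis. *)
Lemma spectral_congr n (H H2 S : 'M[{poly C}]_n) :
  H = parah S *m H2 *m S -> (forall z, z + z^* <= 0 -> ev z S \in unitmx) ->
  (parah H2 = H2 -> axis_posdef H2 -> has_spectral_factor H2) ->
  parah H = H -> axis_posdef H -> has_spectral_factor H.
Proof.
move=> eH uS IH hH pH.
have dS : \det S != 0.
  have := uS 0; rewrite conjC0 addr0 lexx unitmxE det_map_mx unitfE => /(_ isT).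
  by apply: contraNneq => e; rewrite e rmorph0.
have [] := IH.
- apply/eqP; rewrite -subr_eq0; apply/eqP; apply: (mulmxI_det dS).
  apply: (can_inj (@parahK _ _)).
  have -> : parah 0 = 0 :> 'M[{poly C}]_n.
    by apply/matrixP=> i j; rewrite parahE !mxE rmorph0.
  apply: (mulmxI_det dS); rewrite parahM.
  have -> : parah (parah H2 - H2) = H2 - parah H2.
    by apply/matrixP=> i j; rewrite !(mxE, parahE) rmorphB /= paracK.
  rewrite mulmxBr mulmxBl -eH; move: (hH); rewrite {1}eH !parahM parahK mulmxA => ->.
  by rewrite subrr.
- move=> z hz; have uz : ev z S \in unitmx by apply: uS; rewrite hz.
  have -> : ev z H2 = hadj (invmx (ev z S)) *m ev z H *m invmx (ev z S).
    rewrite eH !map_mxM eval_parah_axis // !mulmxA -hadjM mulmxV //.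
    have -> : hadj 1%:M = 1%:M :> 'M[C]_n.
      by apply/matrixP=> i j; rewrite !mxE rmorph_nat eq_sym.
    by rewrite mul1mx mulmxK.
  apply: posdefC_congr (pH z hz) => v e.
  by rewrite -[v](mulKVmx uz) e mulmx0.
- move=> Q [eQ uQ]; exists (Q *m S); split.
    by rewrite parahM eH eQ !mulmxA.
  by move=> z hz; rewrite map_mxM unitmx_mul uQ ?uS.
Qed.

Lemma mul_parah_replace_col n m (k : 'I_n) c (M : 'M[{poly C}]_(n, m)) i j :
  (parah (replace_col k c) *m M) i j = if i == k then (parah c *m M) 0 j else M i j.
Proof.
rewrite -[M]parahK -!parahM !parahE mulmx_replace_col.
by case: ifP; rewrite ?parahE ?paracK.
Qed.

(** Such a form is a constant Hermitian matrix; unitary diagonalisation and square roots of the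
    positive eigenvalues factor it. *)
Lemma spectral_constant n (H : 'M[{poly C}]_n) :
  (forall i j, size (H i j) <= 1)%N -> parah H = H -> axis_posdef H ->
  has_spectral_factor H.
Proof.
move=> sH hH pH; pose H0 : 'M[C]_n := ev 0 H.
have eH : H = map_mx polyC H0.
  apply/matrixP=> i j; rewrite !mxE; have := sH i j => /size1_polyC e.
  by rewrite {1}e /horner_eval horner_coef0.
have p0 : posdefC H0 by apply: pH; rewrite conjC0 addr0.
have h0 : hadj H0 = H0.
  by rewrite /H0 -[in LHS](oppr0) -[X in - X](@conjC0 C) -eval_parah hH.
have hs : H0 \is hermsymmx.
  by apply/is_hermitianmxP; rewrite expr0 scale1r -{1}h0 /hadj map_trmx.
have /orthomx_spectral_subproof[[P D] /= uP e] := hermitian_normalmx hs.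
have uPP : P *m hadj P = 1%:M by move/unitarymxP: (uP); rewrite /hadj map_trmx.
have Pu : P \in unitmx by exact: unitarymx_unit.
have iP : invmx P = hadj P by rewrite -[LHS]mulmx1 -uPP mulKmx.
have Dpos i : 0 < D 0 i.
  have nz : hadj P *m delta_mx i 0 != 0 :> 'cV[C]_n.
    apply: contraTneq isT => /(congr1 (mulmx P)); rewrite mulmxA uPP mul1mx mulmx0.
    by move/matrixP/(_ i 0)/eqP; rewrite !mxE !eqxx oner_eq0.
  have := p0 _ nz; rewrite hadjM hadjK e iP !mulmxA -(mulmxA _ P) uPP mulmx1.
  rewrite -!(mulmxA _ P) uPP mulmx1 -!mulmxA -colE.
  have -> : hadj (delta_mx i 0) = delta_mx 0 i :> 'rV[C]_n.
    by apply/matrixP=> a b; rewrite !mxE rmorph_nat andbC.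
  by rewrite -rowE !mxE eqxx.
pose Q0 : 'M[C]_n := diag_mx (\row_j sqrtC (D 0 j)) *m P.
exists (map_mx polyC Q0); split.
  have -> : parah (map_mx polyC Q0) = map_mx polyC (hadj Q0).
    by apply/matrixP=> i j; rewrite parahE !mxE /parac map_polyC comp_polyC.
  rewrite -map_mxM eH; congr (map_mx _ _).
  rewrite /Q0 hadjM !mulmxA -(mulmxA _ _ (diag_mx _)) e iP.
  congr (_ *m _ *m _); apply/matrixP=> i j.
  rewrite mul_mx_diag !mxE; case: eqVneq => [->|nij]; rewrite ?mulr0n ?rmorph0 ?mul0r //.
  by rewrite ?eqxx !mulr1n geC0_conj ?sqrtC_ge0 ?ltW // -expr2 sqrtCK.
move=> z _; have -> : ev z (map_mx polyC Q0) = Q0.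
  by apply/matrixP=> i j; rewrite !mxE /horner_eval hornerC.
rewrite unitmx_mul Pu andbT unitmxE det_diag unitfE; apply/prodf_neq0 => i _.
by rewrite mxE sqrtC_eq0 gt_eqF.
Qed.

Lemma herm_entry n (H : 'M[{poly C}]_n) i j : parah H = H -> H i j = parac (H j i).
Proof. by move=> h; rewrite -{1}h parahE. Qed.

(** By symmetry row [k] vanishes at [- l^*]. Since [l] is off the axis, the diagonal entry is
    divisible by both linear factors, so the column factor and its paraconjugate can be removed
    together. *)
Lemma divide_column n (H : 'M[{poly C}]_n) k l :
  parah H = H -> 0 < l + l^* -> (forall i, root (H i k) l) ->
  exists H2 : 'M[{poly C}]_n,
    let D := diag_mx (\row_j if j == k then 'X - l%:P else 1) in
    [/\ H = parah D *m H2 *m D,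
      forall i j, i != k -> j != k -> H2 i j = H i j,
      forall i, i != k -> H i k = H2 i k * ('X - l%:P),
      forall j, j != k -> H k j = parac ('X - l%:P) * H2 k j
      & H k k = parac ('X - l%:P) * H2 k k * ('X - l%:P)].
Proof.
move=> hH lpos rH.
have [g gE] : exists g : 'I_n -> {poly C}, forall i, H i k = g i * ('X - l%:P).
  exists (fun i => H i k %/ ('X - l%:P)) => i; rewrite divpK // dvdp_XsubCl; exact: rH.
have [r rE] : exists r, g k = parac ('X - l%:P) * r.
  have nl : - l^* != l.
    apply: contraTneq lpos => e; by rewrite -{1}e addNr ltxx.
  have : root (g k) (- l^*).
    have : root (H k k) (- l^*).
      rewrite /root (herm_entry k k hH) horner_parac rmorphN /= conjCK opprK.
      by rewrite (rootP (rH k)) conjC0.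
    by rewrite gE rootM root_XsubC (negPf nl) orbF.
  case/factor_theorem => r e; exists (- r); rewrite paracXsubC mulrNN e mulrC //.
exists (\matrix_(i, j) if j == k then (if i == k then r else g i)
                 else if i == k then parac (g j) else H i j) => D.
split; last 4 first.
- by move=> i j /negPf ni /negPf nj; rewrite mxE ni nj.
- by move=> i /negPf ni; rewrite mxE eqxx ni.
- by move=> j /negPf nj; rewrite mxE eqxx nj (herm_entry _ _ hH) gE rmorphM mulrC.
- by rewrite mxE !eqxx -rE.
have -> : parah D = diag_mx (\row_j if j == k then parac ('X - l%:P) else 1).
  apply/matrixP=> i j; rewrite parahE !mxE; case: (eqVneq i j) => [->|nij].
    by rewrite !mulr1n; case: ifP => _ //; rewrite (rmorph1 parac).
  by rewrite !mulr0n rmorph0.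
apply/matrixP=> i j; rewrite mul_mx_diag mxE mul_diag_mx !mxE.
case: (eqVneq j k) => [->|nj]; case: (eqVneq i k) => [->|ni].
- by rewrite -rE -gE.
- by rewrite mul1r gE.
- by rewrite mulr1 (herm_entry _ _ hH) gE rmorphM mulrC.
- by rewrite mul1r mulr1.
Qed.

Lemma eval_replace_col n (k : 'I_n) (c : 'cV[{poly C}]_n) z :
  ev z (replace_col k c) = replace_col k (ev z c).
Proof.
by apply/matrixP=> i j; rewrite !mxE; case: ifP => _ //; rewrite rmorph_nat.
Qed.

Lemma parah1 n : parah 1%:M = 1%:M :> 'M[{poly C}]_n.
Proof. by apply/matrixP=> i j; rewrite parahE !mxE rmorph_nat eq_sym. Qed.

Lemma replace_col_congrE n (H : 'M[{poly C}]_n) k (c : 'cV[{poly C}]_n) i j : parah H = H ->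
  (parah (replace_col k c) *m H *m replace_col k c) i j =
  if j == k then (if i == k then (parah c *m (H *m c)) 0 0 else (H *m c) i 0)
  else if i == k then parac ((H *m c) j 0) else H i j.
Proof.
move=> hH; rewrite mulmx_replace_col -mulmxA !mul_parah_replace_col; do 2!case: ifP => // _.
by rewrite -[H in LHS]hH -parahM parahE.
Qed.

(** With pivot 1 the operation is unimodular, so its inverse is invertible at every point, as the
    congruence requires. *)
Lemma replace_col_spectral n (H : 'M[{poly C}]_n) k (c : 'cV[{poly C}]_n) : c k 0 = 1 ->
  let H2 := parah (replace_col k c) *m H *m replace_col k c in
  (parah H2 = H2 -> axis_posdef H2 -> has_spectral_factor H2) ->
  parah H = H -> axis_posdef H -> has_spectral_factor H.
Proof.
move=> ck H2; apply: (@spectral_congr _ _ _ (replace_col k (delta_mx k 0 *+ 2 - c))).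
  rewrite /H2 !mulmxA -parahM replace_col_mulV // parah1 mul1mx.
  by rewrite -mulmxA replace_col_mulV // mulmx1.
move=> z _; rewrite eval_replace_col replace_col_unit // !mxE !eqxx ck.
by rewrite addrK /horner_eval hornerC.
Qed.

(* Reduction of a positive definite form over C[xi] relative to degree weights [a]:
   as long as [a] is not zero, either the matrix of top coefficients is singular,
   and a column operation lowers a weight, or the determinant has a root in the
   open right half plane that can be split off a column. *)
Theorem spectral_factorization n (a : 'I_n -> nat) (H : 'M[{poly C}]_n) :
  parah H = H -> (forall i j, size (H i j) <= (a i + a j).+1)%N ->
  axis_posdef H -> has_spectral_factor H.
Proof.
move: {2}(\sum_i a i)%N (leqnn (\sum_i a i)) => N.
elim: N a H => [|N IH] a H sN hH sH pH.
(* With all weights zero the form is constant; this settles the base case and one case of the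
   inductive step. *)
all: have [a0|apos] := posnP (\sum_i a i);
  first by apply: spectral_constant => // i j; apply: (leq_trans (sH i j));
    move/eqP: a0; rewrite sum_nat_eq0 => /forallP h; rewrite (eqP (h i)) (eqP (h j)).
  by move: apos; rewrite ltnNge sN.
have {IH} IH k (H2 : 'M[{poly C}]_n) : (0 < a k)%N ->
    (forall i j, size (H2 i j) <= ((if i == k then (a k).-1 else a i) +
        (if j == k then (a k).-1 else a j)).+1)%N ->
    parah H2 = H2 -> axis_posdef H2 -> has_spectral_factor H2.
  move=> ak s2 h2 p2; apply: (IH (fun i => if i == k then (a k).-1 else a i)) => //.
  by rewrite -ltnS; apply: leq_trans (sum_decr ak) sN.
pose L := \matrix_(i, j) (H i j)`_(a i + a j).
have [dL0|dL] := eqVneq (\det L) 0.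
  have [v nz Lv] := kernel_vector dL0.
  have [k [s [ck amax]]] := max_pivot a nz; set c0 := s *: v in ck amax.
  have Lc : L *m c0 = 0 by rewrite -scalemxAr Lv scaler0.
  move: c0 ck amax Lc => c0 ck amax Lc.
  (* The exponents make all terms of [(H *m c) i 0] reach degree [a i + a k] together, with total
     coefficient [(L *m c0) i 0], which is zero. On the support of [c0] the subtraction is exact. *)
  pose c : 'cV[{poly C}]_n := \col_j (c0 j 0 *: 'X^(a k - a j)).
  have ck1 : c k 0 = 1 by rewrite mxE ck subnn scale1r.
  have sc j : c j 0 = 0 \/ (a j <= a k)%N /\ (size (c j 0)%R <= (a k - a j).+1)%N.
    rewrite mxE; have [->|nzj] := eqVneq (c0 j 0) 0; first by left; rewrite scale0r.
    by right; rewrite amax // size_scale // size_polyXn.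
  have sg i : (size ((H *m c) i 0)%R <= a i + a k)%N.
    apply: leq_size_coef0.
      apply: size_mulmx_leq => j; case: (sc j) => [->|[aj sj]]; first by rewrite mulr0 size_poly0.
      by apply: (size_mul_bound (sH i j) sj); lia.
    move/matrixP: Lc => /(_ i 0); rewrite !mxE coef_sum => e; rewrite -[RHS]e.
    apply: eq_bigr => j _; rewrite !mxE -scalerAr coefZ coefMXn mulrC.
    have [->|nzj] := eqVneq (c0 j 0) 0; first by rewrite !mulr0.
    have aj := amax _ nzj; rewrite ltnNge (leq_trans (leq_subr _ _) (leq_addl _ _)) /=.
    by congr (_`_ _ * _); lia.
  apply: (@replace_col_spectral _ H k c) => // h2 p2.
  set H2 := parah _ *m _ *m _ in h2 p2 *.
  have H2kk : H2 k k = (parah c *m (H *m c)) 0 0 by rewrite replace_col_congrE // eqxx.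
  have s2k : (size (H2 k k) <= a k + a k)%N.
    rewrite H2kk; apply: size_mulmx_leq => j; rewrite parahE.
    case: (sc j) => [->|[aj sj]]; first by rewrite rmorph0 mul0r size_poly0.
    by rewrite mulrC; apply: (size_mul_bound (sg j)); rewrite ?size_parac; first exact: sj; lia.
  have nr := axis_posdef_diag k p2.
  have nz2 : H2 k k != 0.
    by apply: contraNneq (nr 0 _) => [->|]; rewrite ?root0 // conjC0 addr0.
  (* Even degree improves the bound [2 a k - 1] on the degree to [2 a k - 2], as the lowered weight
     demands, and shows [a k] positive. *)
  have odd2 : odd (size (H2 k k)).
    by apply: odd_size_axis => //; rewrite -herm_entry.
  apply: (IH k) => //; first by move: odd2 s2k; case: (a k) => //; case: (size _).
  move=> i j; rewrite replace_col_congrE //.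
  case: (eqVneq j k) => [_|nj]; case: (eqVneq i k) => [_|ni]; last exact: sH.
  - by rewrite -H2kk; move: odd2 s2k; lia.
  - by move: (sg i); lia.
  - by rewrite size_parac; move: (sg j); lia.
(* The coefficient in degree twice the weight sum is [\det L], so the determinant is not
   constant. *)
have sdet : (1 < size (\det H))%N.
  rewrite ltnNge; apply: contra dL => sd; rewrite -(coef_det_top sH).
  by rewrite nth_default // (leq_trans sd) // addn_gt0 apos.
have [l rl lpos] : exists2 l, root (\det H) l & 0 < l + l^*.
  have /closed_rootP[l rl] : size (\det H) != 1%N by rewrite gtn_eqF.
  have nax : l + l^* != 0.
    apply: contraTneq rl => /pH/posdefC_unit.
    by rewrite unitmxE det_map_mx unitfE /root.
  have lr : l + l^* \is Num.real by rewrite CrealE rmorphD /= conjCK addrC.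
  (* A root in the open left half plane is reflected to [- l^*], again a root because [\det H] is
     its own paraconjugate. *)
  move: nax; rewrite real_neqr_lt ?real0 // => /orP[lneg|lpos]; last by exists l.
  exists (- l^*); last by rewrite rmorphN /= conjCK -opprD oppr_gt0 addrC.
  have -> : \det H = parac (\det H) by rewrite -{1}hH /parah det_tr det_map_mx.
  by rewrite /root horner_parac rmorphN /= conjCK opprK (rootP rl) conjC0.
have [v nz Hv] : exists2 v : 'cV[C]_n, v != 0 & ev l H *m v = 0.
  by apply: kernel_vector; rewrite det_map_mx; exact/rootP.
have [k [s [ck amax]]] := max_pivot a nz; set c0 := s *: v in ck amax.
have Hc0 : ev l H *m c0 = 0 by rewrite -scalemxAr Hv scaler0.
move: c0 ck amax Hc0 => c0 ck amax Hc0.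
(* A constant combination suffices: the degree bounds of column [k] survive because [a k] is maximal
   on the support, and the new column vanishes at [l]. *)
pose c : 'cV[{poly C}]_n := map_mx polyC c0.
have ck1 : c k 0 = 1 by rewrite mxE ck.
have sc j : c j 0 = 0 \/ (a j <= a k)%N /\ (size (c j 0)%R <= 1)%N.
  rewrite mxE; have [->|nzj] := eqVneq (c0 j 0) 0; first by left.
  by right; rewrite amax // size_polyC nzj.
have sg i : (size ((H *m c) i 0)%R <= (a i + a k).+1)%N.
  apply: size_mulmx_leq => j; case: (sc j) => [->|[aj sj]]; first by rewrite mulr0 size_poly0.
  by apply: (size_mul_bound (sH i j) sj); lia.
apply: (@replace_col_spectral _ H k c) => // h2 p2.
set H1 := parah _ *m _ *m _ in h2 p2 *.
have ec : ev l c = c0 by apply/matrixP=> i j; rewrite !mxE /horner_eval hornerC.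
have r1 i : root (H1 i k) l.
  have r0 : ev l (H *m c) = 0 by rewrite map_mxM ec.
  rewrite /H1 mulmx_replace_col eqxx -mulmxA.
  have /matrixP/(_ i 0) : ev l (parah (replace_col k c) *m (H *m c)) = 0.
    by rewrite map_mxM r0 mulmx0.
  by rewrite mxE [RHS]mxE /root => /eqP.
have [H2 [e2 d1 d2 d3 d4]] := divide_column h2 lpos r1.
have nr := axis_posdef_diag k p2.
have nz1 : H1 k k != 0.
  by apply: contraNneq (nr 0 _) => [->|]; rewrite ?root0 // conjC0 addr0.
have s1 : (size (H1 k k) <= (a k + a k).+1)%N.
  rewrite replace_col_congrE // eqxx; apply: size_mulmx_leq => j; rewrite parahE.
  case: (sc j) => [->|[aj sj]]; first by rewrite rmorph0 mul0r size_poly0.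
  by rewrite mulrC; apply: (size_mul_bound (sg j)); rewrite ?size_parac; first exact: sj; lia.
have szM (p : {poly C}) : p != 0 -> size (p * ('X - l%:P)) = (size p).+1.
  by move=> pz; rewrite size_mul ?polyXsubC_eq0 // size_XsubC addn2.
have szM' (p : {poly C}) : p != 0 -> size (parac ('X - l%:P) * p) = (size p).+1.
  move=> pz; rewrite size_mul // ?size_parac ?size_XsubC //.
  by rewrite -size_poly_eq0 size_parac size_XsubC.
have nz2 : H2 k k != 0 by apply: contraNneq nz1 => e; rewrite d4 e mulr0 mul0r.
(* Removing both factors lowers the degree of the diagonal entry by two, which matches a weight
   [a k] smaller by one. *)
have s2 : size (H1 k k) = (size (H2 k k)).+2.
  rewrite d4 szM ?szM' // mulf_neq0 //.
  by rewrite -size_poly_eq0 size_parac size_XsubC.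
have pos2 : (0 < size (H2 k k))%N by rewrite size_poly_gt0.
apply: (spectral_congr e2) => //.
  move=> z hz; rewrite map_diag_mx unitmxE det_diag unitfE; apply/prodf_neq0 => j _.
  rewrite !mxE /= /horner_eval; case: ifP => _; last by rewrite hornerC oner_eq0.
  rewrite hornerXsubC subr_eq0; apply: contraTneq hz => ->.
  by rewrite -real_ltNge ?real0 // CrealE rmorphD /= conjCK addrC.
apply: (IH k); first by move: s1; rewrite s2; lia.
move=> i j; case: (eqVneq j k) => [->|nj]; case: (eqVneq i k) => [->|ni].
- by move: s1; rewrite s2; lia.
- have [->|nzi] := eqVneq (H2 i k) 0; first by rewrite size_poly0.
  have := sg i; have : H1 i k = (H *m c) i 0 by rewrite replace_col_congrE // eqxx (negPf ni).
  by move=> <-; rewrite d2 // szM //; lia.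
- have [->|nzj] := eqVneq (H2 k j) 0; first by rewrite size_poly0.
  have := sg j; have : H1 k j = parac ((H *m c) j 0) by rewrite replace_col_congrE // eqxx (negPf nj).
  by rewrite -(size_parac ((H *m c) j 0)) => <-; rewrite d3 // szM' //; lia.
- by rewrite d1 // replace_col_congrE // (negPf ni) (negPf nj).
Qed.

(** * Lyapunov inequality *)

Definition psd n (K : 'M[C]_n) := forall x : 'rV[C]_n, 0 <= (x *m K *m hadj x) 0 0.

Lemma hadj0 m n : hadj (0 : 'M[C]_(m, n)) = 0.
Proof. by apply/matrixP=> i j; rewrite !mxE conjC0. Qed.

Lemma hadjD m n (M N : 'M[C]_(m, n)) : hadj (M + N) = hadj M + hadj N.
Proof. by apply/matrixP=> i j; rewrite !mxE rmorphD. Qed.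

Lemma hadjZ m n a (M : 'M[C]_(m, n)) : hadj (a *: M) = a^* *: hadj M.
Proof. by apply/matrixP=> i j; rewrite !mxE rmorphM. Qed.

Lemma hadj_row m n1 n2 (M : 'M[C]_(m, n1)) (N : 'M[C]_(m, n2)) :
  hadj (row_mx M N) = col_mx (hadj M) (hadj N).
Proof. by rewrite /hadj map_row_mx tr_row_mx. Qed.

Lemma form_ge0 n (x : 'rV[C]_n) : 0 <= (x *m hadj x) 0 0.
Proof. by rewrite mxE sumr_ge0 // => i _; rewrite !mxE mul_conjC_ge0. Qed.

Lemma form_eq0 n (x : 'rV[C]_n) : (x *m hadj x) 0 0 = 0 -> x = 0.
Proof.
rewrite mxE => e; apply/matrixP=> i j; rewrite ord1 [RHS]mxE.
have h : forall l, true -> 0 <= x 0 l * hadj x l 0 by move=> l _; rewrite !mxE mul_conjC_ge0.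
have /eqP : x 0 j * hadj x j 0 = 0 by apply: (psumr_eq0P h e).
by rewrite !mxE mul_conjC_eq0 => /eqP.
Qed.

(** Otherwise moving from [x] a little way against [x *m K] makes the form negative. *)
Lemma psd_null n (K : 'M[C]_n) (x : 'rV[C]_n) : hadj K = K -> psd K ->
  (x *m K *m hadj x) 0 0 = 0 -> x *m K = 0.
Proof.
move=> hK pK; set y := x *m K => x0; apply: form_eq0.
set b := (y *m hadj y) 0 0; pose g := (y *m K *m hadj y) 0 0.
have b0 : 0 <= b := form_ge0 y; have g0 : 0 <= g := pK y.
apply/eqP; rewrite eq_le b0 andbT real_leNgt ?ger0_real //; apply/negP => bpos.
have g1 : 0 < g + 1 by rewrite ltr_wpDl.
(* This step length gives the value [- b^2 (g + 2) / (g + 1)^2]; the added 1 covers [g = 0]. *)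
pose s := - (b / (g + 1)).
have sr : s^* = s by apply/CrealP; rewrite rpredN rpredM ?rpredV ?gtr0_real.
have := pK (x + s *: y); rewrite hadjD hadjZ sr !mulmxDl !mulmxDr.
rewrite -!scalemxAl -!scalemxAr -/y !scalerA.
have -> : y *m K *m hadj x = y *m hadj y by rewrite -mulmxA -{1}hK -hadjM.
have entD (M N : 'M[C]_1) : (M + N) 0 0 = M 0 0 + N 0 0 by rewrite mxE.
have entZ r (M : 'M[C]_1) : (r *: M) 0 0 = r * M 0 0 by rewrite mxE.
rewrite !entD !entZ -/b -/g x0 add0r.
suff -> : s * b + (s * b + s * s * g) = - (b ^+ 2 * (g + 2)) / (g + 1) ^+ 2.
  rewrite pmulr_lge0 ?invr_gt0 ?exprn_gt0 // oppr_ge0 => h.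
  have : 0 < b ^+ 2 * (g + 2) by rewrite mulr_gt0 ?exprn_gt0 // ltr_wpDl.
  by move=> /(le_lt_trans h); rewrite ltxx.
have nz : g + 1 != 0 by rewrite gt_eqF.
by rewrite /s; field.
Qed.

Lemma lyapunov_form n (A K : 'M[C]_n) (x : 'rV[C]_n) : hadj K = K ->
  x *m (A *m K + K *m hadj A) *m hadj x =
  (x *m A) *m hadj (x *m K) + (x *m K) *m hadj (x *m A).
Proof. by move=> hK; rewrite mulmxDr mulmxDl !hadjM hK !mulmxA. Qed.

(* Deflation along the first basis vector.  If its form [k] vanishes, then the
   off-diagonal block [h] of [K] is an eigenvector of [A2] for an eigenvalue in the open right half
   plane, hence zero; in all cases [h = k g] and the Schur complement is defined. *)
Lemma lyapunov_trig n (A K : 'M[C]_n) : is_trig_mx A ->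
  (forall i, A i i + (A i i)^* < 0) -> hadj K = K ->
  psd (- (A *m K + K *m hadj A)) -> psd K.
Proof.
elim: n A K => [|n IH] A K; first by move=> _ _ _ _ x; rewrite !mxE big_ord0.
rewrite -[n.+1]/(1 + n)%N in A K *.
rewrite -[A]submxK -[K]submxK.
move: (ulsubmx A) (ursubmx A) (dlsubmx A) (drsubmx A) => a0 ur c A2.
move: (ulsubmx K) (ursubmx K) (dlsubmx K) (drsubmx K) => k0 hs h K2 {A K}.
move=> trA Aneg hK pS.
have ur0 : ur = 0.
  apply/matrixP=> i j; move/is_trig_mxP: trA => /(_ (lshift n i) (rshift 1 j)).
  by rewrite block_mxEur => ->; rewrite ?mxE //= ord1.
have [a ha] : exists a, a0 = a%:M by exists (a0 0 0); rewrite -mx11_scalar.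
have [k hk] : exists k, k0 = k%:M by exists (k0 0 0); rewrite -mx11_scalar.
rewrite {}ur0 {}ha in trA Aneg pS; rewrite {}hk in hK pS *.
have [kR hhs hK2] : [/\ k^* = k, hs = hadj h & hadj K2 = K2].
  move: hK; rewrite {1}/hadj map_block_mx tr_block_mx => /eq_block_mx[e1 e2 _ e4].
  by split => //; move/matrixP: e1 => /(_ 0 0); rewrite !mxE eqxx.
rewrite {}hhs in hK pS *; set A := block_mx _ _ _ _ in trA Aneg pS.
set K := block_mx _ _ _ _ in hK pS *.
have aneg : a + a^* < 0 by have := Aneg (lshift n 0); rewrite block_mxEul mxE eqxx.
have A2neg i : A2 i i + (A2 i i)^* < 0 by have := Aneg (rshift 1 i); rewrite block_mxEdr.
have trA2 : is_trig_mx A2.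
  apply/is_trig_mxP=> i j ij; move/is_trig_mxP: trA => /(_ (rshift 1 i) (rshift 1 j)).
  by rewrite block_mxEdr => -> //=; rewrite !add1n ltnS.
have pS0 := pS.
have {}pS (x : 'rV[C]_(1 + n)) :
    ((x *m A) *m hadj (x *m K) + (x *m K) *m hadj (x *m A)) 0 0 <= 0.
  by have := pS x; rewrite mulmxN mulNmx mxE oppr_ge0 lyapunov_form.
have xAE (t : 'M[C]_1) y : row_mx t y *m A = row_mx (t *m a%:M + y *m c) (y *m A2).
  by rewrite mul_row_block mulmx0 add0r.
have xKE (t : 'M[C]_1) y : row_mx t y *m K =
    row_mx (t *m k%:M + y *m h) (t *m hadj h + y *m K2) by rewrite mul_row_block.
pose e0 : 'rV[C]_(1 + n) := row_mx 1%:M 0.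
have e0A : e0 *m A = row_mx a%:M 0 by rewrite xAE !mul0mx mul1mx addr0.
have e0K : e0 *m K = row_mx k%:M (hadj h) by rewrite xKE !mul0mx !mul1mx !addr0.
have hadj_sc z : hadj z%:M = (z^*)%:M :> 'M[C]_1.
  by apply/matrixP=> i j; rewrite !ord1 !mxE !eqxx.
have S00 : (a + a^*) * k <= 0.
  have := pS e0; rewrite e0A e0K !hadj_row !mul_row_col !hadj_sc mul0mx hadj0 mulmx0.
  by rewrite !addr0 kR -!scalar_mxM -raddfD /= mxE eqxx mulr1n [k * _]mulrC mulrDl.
have kge0 : 0 <= k by move: S00; rewrite nmulr_rle0.
have h0 : k = 0 -> h = 0.
  move=> kz; set S := _ + _ in pS0.
  have hS : hadj (- S) = - S.
    by rewrite -scaleN1r hadjZ rmorphN1 hadjD !hadjM hadjK hK addrC.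
  (* The first basis vector is isotropic for the semidefinite [- S], hence in its kernel; the lower
     block of that relation is the eigenvector equation for [h]. *)
  have eS : e0 *m (- S) = 0.
    apply: (psd_null hS pS0); rewrite mulmxN mulNmx mxE lyapunov_form // e0A e0K.
    rewrite !hadj_row !mul_row_col !hadj_sc mul0mx hadj0 mulmx0 kz conjC0.
    by rewrite !addr0 -!scalar_mxM mulr0 mul0r raddf0 addr0 mxE oppr0.
  have : S *m hadj e0 = 0.
    by rewrite -[S]opprK mulNmx -{1}hS -hadjM eS hadj0 oppr0.
  rewrite mulmxDl -!mulmxA -{1}hK -!hadjM e0A e0K !hadj_row hadjK hadj0.
  rewrite !mul_block_col mulmx0 addr0 add_col_mx -[0 in RHS]vsubmxK.
  case/eq_col_mx => _; rewrite !hadj_sc kR kz raddf0 mulmx0 add0r => e.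
  (* The diagonal entries [A2 i i + a^*] have negative real part, so this triangular matrix is
     invertible. *)
  have u : A2 + (a^*)%:M \in unitmx.
    rewrite unitmxE unitfE det_trig.
      apply/prodf_neq0 => i _; rewrite !mxE eqxx mulr1n; apply/negP => /eqP z0.
      have : A2 i i + (A2 i i)^* + (a + a^*) < 0 by rewrite -oppr_gt0 opprD addr_gt0 ?oppr_gt0.
      have -> : A2 i i + (A2 i i)^* + (a + a^*) = (A2 i i + a^*) + (A2 i i + a^*)^*.
        by rewrite rmorphD /= conjCK; ring.
      by rewrite z0 conjC0 addr0 ltxx.
    apply/is_trig_mxP=> i j ij; rewrite !mxE; move/is_trig_mxP: trA2 => -> //.
    by rewrite add0r; case: eqP ij => // ->; rewrite ltnn.
  have : (A2 + (a^*)%:M) *m h = 0.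
    rewrite mulmxDl mul_scalar_mx; move: e; rewrite mul_mx_scalar mulmx0 addr0 => ->.
    by apply/matrixP=> i j; rewrite !mxE.
  by move/(congr1 (mulmx (invmx (A2 + (a^*)%:M)))); rewrite mulKmx // mulmx0.
have [g hg] : exists g, h = k *: g.
  exists (k^-1 *: h); have [kz|nk] := eqVneq k 0; first by rewrite h0 // kz scale0r.
  by rewrite scalerA divff // scale1r.
pose K3 := K2 - g *m hadj h.
have hK3 : hadj K3 = K3.
  rewrite /K3 -scaleN1r hadjD hadjZ rmorphN1 hadjM hadjK hK2 hg hadjZ kR.
  by rewrite -scalemxAl -scalemxAr.
(* The vectors [(- y g, y)] are [K]-orthogonal to the first basis vector; on them the form is the
   Schur complement [K3], and the inequality becomes the one for [A2] and [K3]. *)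
have xK (y : 'rV[C]_n) : row_mx (- (y *m g)) y *m K = row_mx 0 (y *m K3).
  rewrite xKE mulNmx mul_mx_scalar scalemxAr -hg addNr; congr row_mx.
  by rewrite /K3 mulmxBr mulmxA mulNmx addrC.
have pK3 : psd K3.
  apply: (IH A2) => // y; rewrite mulmxN mulNmx mxE oppr_ge0 lyapunov_form //.
  have := pS (row_mx (- (y *m g)) y).
  by rewrite xK xAE !hadj_row !mul_row_col hadj0 mulmx0 mul0mx !add0r.
move=> x; rewrite -[x]hsubmxK; move: (lsubmx x) (rsubmx x) => s y.
pose t := s + y *m g.
have -> : row_mx s y = row_mx t 0 + row_mx (- (y *m g)) y.
  by rewrite add_row_mx add0r addrK.
have tK : row_mx t 0 *m K = row_mx (k *: t) (t *m hadj h).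
  by rewrite xKE !mul0mx !addr0 mul_mx_scalar.
rewrite mulmxDl xK tK hadjD mulmxDl !mulmxDr !hadj_row !mul_row_col.
rewrite hadj0 !mulmx0 !mul0mx !addr0 !add0r.
have -> : hadj (- (y *m g)) = - hadj (y *m g).
  by rewrite -scaleN1r hadjZ rmorphN1 scaleN1r.
have -> : k *: t *m - hadj (y *m g) + t *m hadj h *m hadj y = 0.
  by rewrite hg hadjZ kR hadjM !mulmxN -!scalemxAl -!scalemxAr -scalemxAl !mulmxA addNr.
rewrite addr0 mxE addr_ge0 //; last by rewrite -mulmxDr; exact: pK3.
by rewrite -scalemxAl mxE mulr_ge0 // form_ge0.
Qed.

(** Schur triangularisation: unitary similarity preserves the inequality and puts the eigenvalues on
    the diagonal. *)
Lemma lyapunov_psd n (A K : 'M[C]_n) :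
  (forall a, eigenvalue A a -> a + a^* < 0) -> hadj K = K ->
  psd (- (A *m K + K *m hadj A)) -> psd K.
Proof.
case: n A K => [|n] A K; first by move=> _ _ _ x; rewrite !mxE big_ord0.
move=> eig hK pS; have [P uP trA] := Schur A (ltn0Sn n).
have Pu := unitarymx_unit uP.
have PP : P *m hadj P = 1%:M by move/unitarymxP: uP; rewrite /hadj map_trmx.
have PP' : hadj P *m P = 1%:M by apply: mulmx1C.
have iP : invmx P = hadj P by rewrite -[LHS]mulmx1 -PP mulKmx.
have {}trA : is_trig_mx (P *m A *m hadj P).
  by rewrite -iP -conjumx //; case/andP: trA.
have hK' : hadj (P *m K *m hadj P) = P *m K *m hadj P.
  by rewrite !hadjM hadjK hK mulmxA.
have pK' : psd (P *m K *m hadj P).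
  apply: (lyapunov_trig trA _ hK') => [i|x].
    apply: eig; have : eigenvalue (P *m A *m hadj P) ((P *m A *m hadj P) i i).
      rewrite eigenvalue_root_char (char_poly_trig trA); move: (P *m A *m _) => M.
      by rewrite (bigD1 i) //= rootM root_XsubC eqxx.
    case/eigenvalueP => v e nz; apply/eigenvalueP; exists (v *m P).
      by rewrite scalemxAl -e -!mulmxA PP' mulmx1.
    apply: contraNneq nz => vP; by rewrite -[v]mulmx1 -PP mulmxA vP mul0mx.
  have := pS (x *m P); rewrite !mulmxN !mulNmx hadjM.
  suff -> : P *m A *m hadj P *m (P *m K *m hadj P) +
     P *m K *m hadj P *m hadj (P *m A *m hadj P) = P *m (A *m K + K *m hadj A) *m hadj P.
    by rewrite !mulmxA.
  by rewrite mulmxDr mulmxDl !hadjM hadjK !mulmxA -!(mulmxA _ (hadj P) P) PP' !mulmx1.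
move=> x; have := pK' (x *m hadj P).
by rewrite hadjM hadjK !mulmxA -!(mulmxA _ (hadj P) P) PP' !mulmx1.
Qed.
End Hermitian.

Section RealSystems.
Variable R : realType.
Local Notation C := R[i].
Local Notation rc := (real_complex R).
Local Notation rho := (map_poly rc).
Local Notation cst := (map_mx (@polyC R)).
Local Notation ev z := (map_mx (horner_eval z)).

(** * Real spectral factors *)

Definition rpara m n (M : 'M[{poly R}]_(m, n)) : 'M[{poly R}]_(n, m) :=
  (map_mx (comp_poly (- 'X)) M)^T.

Lemma rparaE m n (M : 'M[{poly R}]_(m, n)) i j : rpara M i j = M j i \Po (- 'X).
Proof. by rewrite !mxE. Qed.

Lemma rparaM m n p (M : 'M[{poly R}]_(m, n)) (N : 'M[{poly R}]_(n, p)) :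
  rpara (M *m N) = rpara N *m rpara M.
Proof. by rewrite /rpara map_mxM trmx_mul. Qed.

Lemma compNK : involutive (comp_poly (- 'X) : {poly R} -> {poly R}).
Proof.
by move=> p; apply/polyP=> k; rewrite !coef_compN mulrA -exprMn mulrNN mulr1 expr1n mul1r.
Qed.

Lemma size_compN (p : {poly R}) : size (p \Po (- 'X)) = size p.
Proof.
by rewrite size_comp_poly2 // size_polyN size_polyX.
Qed.

Lemma diag_sub_bilin p n (M L : 'M[{poly R}]_(p, n)) :
  diag_sub (bilin M L) = rpara M *m L.
Proof.
apply/matrixP=> i j; rewrite !mxE horner_sum; apply: eq_bigr => r _.
by rewrite hornerM hornerC !mxE.
Qed.

Lemma diag_subD n (P Q : 'M[{poly {poly R}}]_n) : diag_sub (P + Q) = diag_sub P + diag_sub Q.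
Proof. by apply/matrixP=> i j; rewrite !mxE hornerD. Qed.

Lemma conj_rc (x : R) : (rc x)^* = rc x.
Proof. by apply/CrealP; rewrite complex_real. Qed.

Lemma conjCc (z : C) : z^* = conjc z.
Proof. by []. Qed.

Lemma parac_rho (p : {poly R}) : parac (rho p) = rho (p \Po (- 'X)).
Proof.
apply/polyP=> k; rewrite coef_parac !coef_map /= conj_rc coef_compN.
by rewrite rmorphM rmorphXn rmorphN1.
Qed.

Lemma parah_rho m n (M : 'M[{poly R}]_(m, n)) : parah (map_mx rho M) = map_mx rho (rpara M).
Proof. by apply/matrixP=> i j; rewrite parahE !mxE parac_rho. Qed.

Lemma evalCmxE m n (M : 'M[{poly R}]_(m, n)) z : evalCmx M z = ev z (map_mx rho M).
Proof. by apply/matrixP=> i j; rewrite !mxE. Qed.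

Lemma evalCmxM m n p (M : 'M[{poly R}]_(m, n)) (N : 'M[{poly R}]_(n, p)) z :
  evalCmx (M *m N) z = evalCmx M z *m evalCmx N z.
Proof. by rewrite !evalCmxE !map_mxM. Qed.

Lemma det_evalCmx n (M : 'M[{poly R}]_n) z : \det (evalCmx M z) = evalC (\det M) z.
Proof. by rewrite evalCmxE !det_map_mx. Qed.

Lemma adj_evalCmx n (M : 'M[{poly R}]_n) z : \adj (evalCmx M z) = evalCmx (\adj M) z.
Proof. by rewrite !evalCmxE !map_mx_adj. Qed.

Lemma evalC_conj (p : {poly R}) z : evalC p (z^*) = (evalC p z)^*.
Proof.
rewrite /evalC -horner_map -map_poly_comp /=; congr (_.[_]).
by apply/eq_map_poly => x; rewrite /= conj_rc.
Qed.

Lemma evalCmx_conj m n (M : 'M[{poly R}]_(m, n)) z :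
  evalCmx M (z^*) = map_mx Num.conj (evalCmx M z).
Proof. by apply/matrixP=> i j; rewrite !mxE evalC_conj. Qed.

Lemma hurwitz_unit n (P : 'M[{poly R}]_n) z : hurwitz P -> 0 <= complex.Re z ->
  evalCmx P z \in unitmx.
Proof.
move=> hP hz; rewrite unitmxE det_evalCmx unitfE; apply/negP => r.
by have := hP z r; rewrite ltNge hz.
Qed.

Lemma rat_evalE n (N : 'M[{poly R}]_n) (P : 'M[{poly R}]_n) z : evalCmx P z \in unitmx ->
  rat_eval (N *m \adj P) (\det P) z = evalCmx N z *m invmx (evalCmx P z).
Proof.
move=> uP; rewrite /invmx uP det_evalCmx adj_evalCmx -scalemxAr -evalCmxM.
by apply/matrixP=> i j; rewrite [LHS]mxE [RHS]mxE [in RHS]mxE mulrC.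
Qed.

(** On the axis [- z] is the conjugate of [z]. Evaluating the positive real form at [R1(z) v] clears
    the denominators, and [R1(z)] is invertible there since [R1] is Hurwitz. *)
Lemma axis_posdef_spr n (R1 R2 : 'M[{poly R}]_n) : hurwitz R1 ->
  strictly_positive_real (R2 *m \adj R1) (\det R1) ->
  axis_posdef (map_mx rho (rpara R1 *m R2 + rpara R2 *m R1)).
Proof.
move=> h1 [_ spr] z hz.
have {hz} [w zE] : exists w, z = Complex 0 w.
  case: z hz => a b /(congr1 (@complex.Re R)) /= /eqP; rewrite -mulr2n mulrn_eq0 /=.
  by move/eqP->; exists b.
have zc : z^* = Complex 0 (- w) by rewrite zE.
have uz : evalCmx R1 z \in unitmx by apply: hurwitz_unit; rewrite // zE.
have uzc : evalCmx R1 z^* \in unitmx by apply: hurwitz_unit; rewrite // zc.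
have := spr w; rewrite -zc -zE (rat_evalE R2 uzc) (rat_evalE R2 uz) => pd v nz.
have unz : evalCmx R1 z *m v != 0.
  by apply: contraNneq nz => e; rewrite -[v](mulKmx uz) e mulmx0.
have := pd _ unz.
have -> : evalCmx R2 z^* *m invmx (evalCmx R1 z^*) =
   map_mx Num.conj (evalCmx R2 z *m invmx (evalCmx R1 z)).
  by rewrite !evalCmx_conj map_mxM map_invmx.
set G := _ *m invmx _.
have GE : G *m (evalCmx R1 z *m v) = evalCmx R2 z *m v by rewrite /G -mulmxA mulKmx.
change ((map_mx Num.conj G)^T) with (hadj G).
change ((map_mx conjc (evalCmx R1 z *m v))^T) with (hadj (evalCmx R1 z *m v)).
rewrite mulmxDr mulmxDl -hadjM -[hadj _ *m G *m _]mulmxA GE.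
rewrite map_mxD !map_mxM -!parah_rho map_mxD !map_mxM.
have ax : z + z^* = 0 by rewrite zE; apply/eqP; rewrite eq_complex /= addr0 subrr !eqxx.
rewrite !eval_parah_axis // -!evalCmxE addrC !hadjM.
by rewrite mulmxDr mulmxDl !mulmxA.
Qed.

Definition cre (p : {poly C}) : {poly R} := \poly_(k < size p) complex.Re p`_k.
Definition cim (p : {poly C}) : {poly R} := \poly_(k < size p) complex.Im p`_k.

Lemma cre_cim p : p = rho (cre p) + 'i%C%:P * rho (cim p).
Proof.
by apply/polyP=> k; rewrite coefD coefCM !coef_map /= -complexE.
Qed.

Lemma rho_re (p q r : {poly R}) : rho p = rho q + 'i%C%:P * rho r -> p = q.
Proof.
move=> /polyP e; apply/polyP=> k; have := e k; rewrite coefD coefCM !coef_map /=.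
move/(congr1 (@complex.Re R)) => /= ->.
by rewrite mul0r mulr0 subr0 addr0.
Qed.

(** The coefficients in the highest possible degree [e + e] are squares with the common sign
    [(-1)^e], so they cannot cancel over the reals. *)
Lemma size_sum_squares q (f : 'I_q -> {poly R}) N :
  (size (\sum_r (f r \Po (- 'X)) * f r)%R <= N + N)%N -> forall r, (size (f r) <= N)%N.
Proof.
move=> sN r; rewrite leqNgt; apply/negP => lt.
pose e := (\max_r size (f r)).-1.
have em : (\max_r size (f r) = e.+1)%N.
  by rewrite /e prednK // (leq_trans _ (leq_bigmax r)) // (leq_trans _ lt).
have sf j : (size (f j) <= e.+1)%N by rewrite -em leq_bigmax.
have Ne : (N <= e)%N by rewrite -ltnS -em (leq_trans lt) // leq_bigmax.
have c0 : (\sum_r (f r \Po (- 'X)) * f r)`_(e + e) = 0.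
  by rewrite nth_default // (leq_trans sN) // leq_add.
have c1 j : (f j)`_e = 0.
  move: c0; rewrite coef_sum.
  under eq_bigr => i _ do rewrite coef_mul_top ?size_compN // coef_compN -mulrA.
  rewrite -mulr_sumr => /eqP; rewrite mulf_eq0 signr_eq0 /= => /eqP s0.
  apply/eqP; rewrite -sqrf_eq0 expr2; apply/eqP.
  by apply: (psumr_eq0P _ s0) => // i _; rewrite -expr2 sqr_ge0.
have : (\max_r size (f r) <= e)%N.
  by apply/bigmax_leqP => j _; apply: leq_size_coef0.
by rewrite em ltnn.
Qed.

(** With [F = Q adj(R1)] and [d = det R1], the identity [F~ F = d~ (R2 adj R1) + d (R2 adj R1)~]
    keeps the degree of the diagonal entries, which are sums of squares, below twice that of [d]. *)
Lemma sp_right_factor n q (R1 R2 : 'M[{poly R}]_n) (Q : 'M[{poly R}]_(q, n)) :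
  \det R1 != 0 -> sp_right R2 R1 -> rpara R1 *m R2 + rpara R2 *m R1 = rpara Q *m Q ->
  sp_right Q R1.
Proof.
move=> d0 sp e i j; set d := \det R1 in d0 *; set F := Q *m _.
have FF : rpara F *m F = (d \Po (- 'X)) *: (R2 *m \adj R1) + d *: rpara (R2 *m \adj R1).
  rewrite /F !rparaM -[_ *m _ *m (Q *m _)]mulmxA [rpara Q *m _]mulmxA -e.
  rewrite mulmxDl mulmxDr !mulmxA -rparaM mul_mx_adj.
  rewrite -[_ *m R1 *m \adj R1]mulmxA mul_mx_adj mul_mx_scalar.
  congr (_ + _); rewrite -mulmxA -mul_scalar_mx; congr (_ *m _).
  apply/matrixP=> a b; rewrite rparaE !mxE eq_sym.
  by case: eqP => _; rewrite ?mulr1n ?mulr0n ?comp_poly0.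
have dpos : (0 < size d)%N by rewrite size_poly_gt0.
rewrite -(prednK dpos) ltnS.
apply: (@size_sum_squares _ (fun r => F r j)).
have -> : \sum_r (F r j \Po - 'X) * F r j =
    (d \Po - 'X) * (R2 *m \adj R1) j j + d * ((R2 *m \adj R1) j j \Po - 'X).
  transitivity ((rpara F *m F) j j).
    by rewrite [RHS]mxE; apply: eq_bigr => r _; rewrite rparaE.
  by rewrite FF [LHS]mxE; congr (_ + _); rewrite [LHS]mxE ?rparaE.
have arith (x y : nat) : (x < y -> (y + x).-1 <= y.-1 + y.-1)%N by lia.
apply: (leq_trans (size_polyD _ _)); rewrite geq_max; apply/andP; split;
  by apply: (leq_trans (size_polyMleq _ _)); rewrite size_compN; apply: arith; exact: sp.
Qed.

Lemma exists_real_factor n (R1 R2 : 'M[{poly R}]_n) : hurwitz R1 ->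
  strictly_positive_real (R2 *m \adj R1) (\det R1) ->
  exists q (Q : 'M[{poly R}]_(q, n)),
    rpara R1 *m R2 + rpara R2 *m R1 = rpara Q *m Q /\
    forall lam : R[i], \rank (col_mx (evalCmx R1 lam) (evalCmx Q lam)) = n.
Proof.
move=> h1 spr; set Phi := _ + _.
have pd := axis_posdef_spr h1 spr.
have rparaK m p (M : 'M[{poly R}]_(m, p)) : rpara (rpara M) = M.
  by apply/matrixP=> i j; rewrite !rparaE compNK.
have rparaD m p (M N : 'M[{poly R}]_(m, p)) : rpara (M + N) = rpara M + rpara N.
  by apply/matrixP=> i j; rewrite !(rparaE, mxE) rmorphD.
have hH : parah (map_mx rho Phi) = map_mx rho Phi.
  by rewrite parah_rho /Phi rparaD !rparaM !rparaK addrC.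
pose N := (\max_(p : 'I_n * 'I_n) size (map_mx rho Phi p.1 p.2))%N.
have [] := spectral_factorization (a := fun _ => N) hH _ pd.
  move=> i j; apply: (@leq_trans N); first exact: (leq_bigmax (i, j)).
  by rewrite -addnS leq_addr.
move=> Q [eQ uQ].
(* For [Q = A + i B] the real part of [Q~ Q] is [A~ A + B~ B], the form of the stacked matrix. *)
pose A := map_mx cre Q; pose B := map_mx cim Q.
have QE : Q = map_mx rho A + 'i%C%:P *: map_mx rho B.
  by apply/matrixP=> i j; rewrite !mxE -cre_cim.
exists (n + n)%N, (col_mx A B); split.
  have -> : rpara (col_mx A B) *m col_mx A B = rpara A *m A + rpara B *m B.
    by rewrite /rpara map_col_mx tr_col_mx mul_row_col.
  have : map_mx rho Phi = map_mx rho (rpara A *m A + rpara B *m B) +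
     'i%C%:P *: map_mx rho (rpara A *m B - rpara B *m A).
    rewrite eQ QE.
    have -> : parah (map_mx rho A + 'i%C%:P *: map_mx rho B) =
       map_mx rho (rpara A) - 'i%C%:P *: map_mx rho (rpara B).
      rewrite -!parah_rho; apply/matrixP=> i j; rewrite !(parahE, mxE).
      rewrite rmorphD rmorphM /=; congr (_ + _); rewrite -mulNr; congr (_ * _).
      rewrite /parac map_polyC comp_polyC -polyCN; congr (_%:P).
      by apply/eqP; rewrite eq_complex /= oppr0 !eqxx.
    rewrite mulmxDr !mulmxBl -!scalemxAl -!scalemxAr scalerA.
    rewrite -rmorphM /= -expr2 sqr_i rmorphN1 scaleN1r opprK !map_mxD map_mxN !map_mxM scalerBr.
    rewrite -!addrA; congr (_ + _); rewrite [RHS]addrCA [RHS]addrA [RHS]addrC.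
    by congr (_ + _); rewrite addrC.
  move/matrixP=> e; apply/matrixP=> i j; have := e i j.
  by rewrite [LHS]mxE [RHS]mxE [X in X + _]mxE [X in _ + X]mxE [X in _ * X]mxE => /rho_re.
move=> lam.
have suff_unit (U : 'M[C]_n) p (M : 'M[C]_(p, n)) : U \in unitmx -> (U <= M)%MS -> \rank M = n.
  move=> uU /mxrankS; rewrite mxrank_unit // => le.
  by apply/eqP; rewrite eqn_leq rank_leq_col.
(* On the closed right half plane [R1] is invertible; on the open left one the complex factor is,
   and its rows are combinations [A + i B] of those of the real factor. *)
case: (lerP 0 (complex.Re lam)) => [pos|neg].
  apply: (suff_unit _ _ _ (hurwitz_unit h1 pos)).
  by rewrite -addsmxE addsmxSl.
apply: (suff_unit (ev lam Q) _ _ _).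
  apply: uQ; rewrite conjCc addcJ -[2%:R]/(rc 1 *+2).
  rewrite -rmorphMn -rmorphM lecR mulrC pmulr_lle0 ?ltr0n // ltW //.
rewrite -addsmxE; apply: submx_trans (addsmxSr _ _).
apply/submxP; exists (row_mx 1%:M 'i%C%:M).
rewrite evalCmxE !map_col_mx mul_row_col mul1mx mul_scalar_mx {1}QE.
by rewrite map_mxD map_mxZ /= /horner_eval hornerC.
Qed.

(** * State space representation *)

Lemma bilinE p n (M L : 'M[{poly R}]_(p, n)) :
  bilin M L = (map_mx (map_poly polyC) M)^T *m map_mx polyC L.
Proof. by apply/matrixP=> i j; rewrite !mxE; apply: eq_bigr => r _; rewrite !mxE. Qed.

Lemma bilinDl p n (M N L : 'M[{poly R}]_(p, n)) : bilin (M + N) L = bilin M L + bilin N L.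
Proof. by rewrite !bilinE map_mxD linearD mulmxDl. Qed.

Lemma bilinDr p n (M N L : 'M[{poly R}]_(p, n)) : bilin L (M + N) = bilin L M + bilin L N.
Proof. by rewrite !bilinE map_mxD mulmxDr. Qed.

Lemma bilinNr p n (M L : 'M[{poly R}]_(p, n)) : bilin L (- M) = - bilin L M.
Proof. by rewrite !bilinE map_mxN mulmxN. Qed.

Lemma bilin_cst p q n (N : 'M[R]_(p, q)) (M : 'M[{poly R}]_(q, n)) (L : 'M[{poly R}]_(p, n)) :
  bilin (cst N *m M) L = bilin M (cst N^T *m L).
Proof.
rewrite !bilinE !map_mxM trmx_mul -mulmxA; congr (_ *m (_ *m _)).
by apply/matrixP=> i j; rewrite !mxE /= map_polyC.
Qed.

Lemma mul_zpe_bilin p n (M L : 'M[{poly R}]_(p, n)) :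
  mul_zpe (bilin M L) = bilin ('X *: M) L + bilin M ('X *: L).
Proof.
apply/matrixP=> i j; rewrite !mxE mulr_sumr -big_split /=; apply: eq_bigr => r _.
rewrite !mxE /zeta_plus_eta mulrDl; congr (_ + _).
  by rewrite rmorphM /= map_polyX mulrA.
by rewrite rmorphM /= mulrCA.
Qed.

Lemma diag_sub_mul_zpe n (P : 'M[{poly {poly R}}]_n) : diag_sub (mul_zpe P) = 0.
Proof.
by apply/matrixP=> i j; rewrite !mxE hornerM hornerD hornerX hornerC addNr mul0r.
Qed.

Lemma rmodE m n (P : 'M[{poly R}]_n) (F : 'M[{poly R}]_(m, n)) :
  F = rmod P F + map_mx (fun e => e %/ \det P) (F *m \adj P) *m P.
Proof. by rewrite /rmod subrK. Qed.

Lemma rmod_sp m n (P : 'M[{poly R}]_n) (F : 'M[{poly R}]_(m, n)) :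
  \det P != 0 -> sp_right (rmod P F) P.
Proof.
move=> d0 i j; rewrite /rmod mulmxBl -mulmxA mul_mx_adj mul_mx_scalar.
have -> : (F *m \adj P - \det P *: map_mx (fun e => e %/ \det P) (F *m \adj P)) i j =
   (F *m \adj P) i j %% \det P.
  rewrite [LHS]mxE [X in _ + X]mxE [X in - X]mxE [X in _ * X]mxE.
  by rewrite {1}(divp_eq ((F *m \adj P) i j) (\det P)) mulrC addrC addKr.
by rewrite ltn_modp.
Qed.

Lemma sp_rightD m n (P : 'M[{poly R}]_n) (F G : 'M[{poly R}]_(m, n)) :
  sp_right F P -> sp_right G P -> sp_right (F + G) P.
Proof.
move=> sF sG i j; rewrite mulmxDl mxE; apply: (leq_ltn_trans (size_polyD _ _)).
by rewrite gtn_max sF sG.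
Qed.

Lemma sp_rightN m n (P : 'M[{poly R}]_n) (F : 'M[{poly R}]_(m, n)) :
  sp_right F P -> sp_right (- F) P.
Proof. by move=> sF i j; rewrite mulNmx mxE size_polyN. Qed.

Lemma sp_right_cst l m n (P : 'M[{poly R}]_n) (F : 'M[{poly R}]_(m, n)) (N : 'M[R]_(l, m)) :
  \det P != 0 -> sp_right F P -> sp_right (cst N *m F) P.
Proof.
move=> d0 sF i j; rewrite -mulmxA.
have dpos : (0 < size (\det P))%N by rewrite size_poly_gt0.
rewrite -(prednK dpos) ltnS; apply: size_mulmx_leq => k; rewrite mxE mul_polyC.
by apply: (leq_trans (size_scale_leq _ _)); rewrite -ltnS prednK //; exact: sF.
Qed.

(** [N] is both polynomial and strictly proper. *)
Lemma sp_right_mulP m n (P : 'M[{poly R}]_n) (N : 'M[{poly R}]_(m, n)) :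
  \det P != 0 -> sp_right (N *m P) P -> N = 0.
Proof.
move=> d0 sF; apply/matrixP=> i j; rewrite [RHS]mxE; apply/eqP/negPn/negP => nz.
have := sF i j; rewrite -mulmxA mul_mx_adj mul_mx_scalar mxE size_mul //.
have : (0 < size (N i j))%N by rewrite size_poly_gt0.
by case: (size (N i j)) => // s _; rewrite addnS /= ltnNge leq_addr.
Qed.

Lemma rho_complex_eq0 (p q : {poly R}) : rho p + 'i%C%:P * rho q = 0 -> p = 0 /\ q = 0.
Proof.
move=> /polyP e.
have h k : p`_k = 0 /\ q`_k = 0.
  have := e k; rewrite coefD coefCM !coef_map coef0 => - [/=].
  by rewrite !mul0r !mul1r subr0 addr0 !add0r.
by split; apply/polyP=> k; case: (h k); rewrite coef0.
Qed.

Section Basis.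
Variables (n p : nat) (P : 'M[{poly R}]_n) (X : 'M[{poly R}]_(p, n)).
Hypotheses (dP : \det P != 0) (bX : state_basis P X).

Lemma basis_sp : sp_right X P. Proof. by case: bX. Qed.

Lemma basis_free m (N : 'M[R]_(m, p)) : cst N *m X = 0 -> N = 0.
Proof.
move=> e; apply/row_matrixP=> i; rewrite row0; case: bX => _ [free _]; apply: free.
by rewrite map_row -row_mul e row0.
Qed.

Lemma basis_coord m (F : 'M[{poly R}]_(m, n)) : sp_right F P ->
  exists N : 'M[R]_(m, p), F = cst N *m X.
Proof.
move=> sF; case: bX => _ [_ gen].
have h i : exists c : 'rV[R]_p, row i F = cst c *m X.
  apply: gen => a j; rewrite -row_mul mxE; exact: sF.
have [f fE] := boolp.choice h.
exists (\matrix_i f i); apply/row_matrixP=> i.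
by rewrite row_mul -map_row rowK.
Qed.

Lemma basis_unique m (al : 'M[R]_(m, p)) (be : 'M[R]_(m, n)) :
  cst al *m X + cst be *m P = 0 -> al = 0 /\ be = 0.
Proof.
move=> e; have be0 : cst be = 0.
  apply: (sp_right_mulP dP).
  have -> : cst be *m P = - (cst al *m X) by apply/eqP; rewrite -addr_eq0 addrC e.
  by apply/sp_rightN/sp_right_cst => //; exact: basis_sp.
split; first by apply: basis_free; move: e; rewrite be0 mul0mx addr0.
by apply/matrixP=> i j; move/matrixP: be0 => /(_ i j); rewrite !mxE => /eqP; rewrite polyC_eq0 => /eqP.
Qed.

(** [X P^-1] is strictly proper, so multiplying by the variable leaves a constant polynomial part,
    the matrix [B]; the strictly proper part lies in the span of the basis. *)
Lemma basis_shift : exists (A : 'M[R]_p) (B : 'M[R]_(p, n)),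
  'X *: X = cst A *m X + cst B *m P.
Proof.
have [A eA] := basis_coord (rmod_sp ('X *: X) dP).
pose Bq := map_mx (fun e => e %/ \det P) ('X *: X *m \adj P).
exists A, (\matrix_(i, j) (Bq i j)`_0).
rewrite -eA {1}(rmodE P ('X *: X)) -/Bq; congr (_ + _ *m _).
apply/matrixP=> i j; rewrite [RHS]mxE [in RHS]mxE; apply: size1_polyC.
rewrite [Bq i j]mxE size_divp // -scalemxAl mxE mulrC.
have := basis_sp i j; set s := size (\det P); set f := (X *m _) i j => sf.
have : (size (f * 'X)%R <= s)%N.
  by have [->|nz] := eqVneq f 0; rewrite ?mul0r ?size_poly0 ?size_mulX.
by move: (size _) => l; lia.
Qed.

(** A left eigenvector [u] gives [('X - a) u X = u B P]. If [P(a)] were invertible, evaluation at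
    [a] would give [u B = 0] and then [u X = 0], against the independence of the rows of [X]. *)
Lemma shift_eigenvalue (A : 'M[R]_p) (B : 'M[R]_(p, n)) a :
  'X *: X = cst A *m X + cst B *m P ->
  eigenvalue (map_mx rc A) a -> evalC (\det P) a = 0.
Proof.
move=> e /eigenvalueP[u uA unz]; apply/eqP/negPn/negP => d0.
have e' : 'X *: map_mx rho X = map_mx rho (cst A) *m map_mx rho X
    + map_mx rho (cst B) *m map_mx rho P.
  by rewrite -!map_mxM -map_mxD -e map_mxZ /= map_polyX.
have rcst k l (N : 'M[R]_(k, l)) : map_mx rho (cst N) = map_mx polyC (map_mx rc N).
  by apply/matrixP=> i j; rewrite !mxE /= map_polyC.
rewrite !rcst in e'.
pose U := map_mx polyC u *m map_mx rho X.
have eU : ('X - a%:P) *: U = map_mx polyC (u *m map_mx rc B) *m map_mx rho P.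
  rewrite scalerBl /U scalemxAr e' mulmxDr !mulmxA -map_mxM uA map_mxZ /=.
  by rewrite -scalemxAl addrC addKr map_mxM.
have uB : u *m map_mx rc B = 0.
  have := congr1 (map_mx (horner_eval a)) eU.
  have h0 : horner_eval a ('X - a%:P) = 0 by rewrite /horner_eval hornerXsubC subrr.
  rewrite map_mxZ /= h0 scale0r map_mxM -evalCmxE.
  have -> : map_mx (horner_eval a) (map_mx polyC (u *m map_mx rc B)) = u *m map_mx rc B.
    by apply/matrixP=> i j; rewrite [LHS]mxE [in LHS]mxE /horner_eval hornerC.
  move/esym/(mulmxI_det _); apply; by rewrite det_evalCmx.
have U0 : U = 0.
  move: eU; rewrite uB map_mx0 mul0mx => /matrixP eU; apply/matrixP=> i j.
  have := eU i j; rewrite mxE [RHS]mxE => /eqP; rewrite mulf_eq0 polyXsubC_eq0 /=.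
  by rewrite [RHS]mxE => /eqP.
(* Independence is given over the reals, so [u] is split into real and imaginary parts. *)
have cc : map_mx (@complex.Re R) u = 0 /\ map_mx (@complex.Im R) u = 0.
  have key (f : 'rV[R]_p) (g : 'rV[R]_p) : u = map_mx rc f + 'i%C *: map_mx rc g ->
      f = 0 /\ g = 0.
    move=> uE.
    have : map_mx rho (cst f *m X) + 'i%C%:P *: map_mx rho (cst g *m X) = 0.
      by rewrite !map_mxM !rcst scalemxAl -mulmxDl -map_mxZ -map_mxD -uE.
    move=> /matrixP h.
    have h2 i j : rho ((cst f *m X) i j) + 'i%C%:P * rho ((cst g *m X) i j) = 0.
      by have := h i j; rewrite [RHS]mxE [LHS]mxE [X in _ + X]mxE ![map_mx rho _ _ _]mxE.
    by split; apply: basis_free; apply/matrixP=> i j; rewrite [RHS]mxE;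
      case: (rho_complex_eq0 (h2 i j)).
  apply: key; apply/matrixP=> i j; by rewrite !mxE -complexE.
case/eqP: unz; apply/matrixP=> i j; case: cc => /matrixP/(_ i j) h1 /matrixP/(_ i j) h2.
move: h1 h2; rewrite !mxE => h1 h2.
by rewrite [u i j]complexE h1 h2 rmorph0 mulr0 addr0.
Qed.
End Basis.

(** * The Lyapunov equation of a stable real matrix *)

Definition stable p (A : 'M[R]_p) :=
  forall a : C, eigenvalue (map_mx rc A) a -> complex.Re a < 0.

Lemma char_poly_tr (F : comNzRingType) p (A : 'M[F]_p) : char_poly A^T = char_poly A.
Proof.
rewrite /char_poly -[RHS]det_tr; congr (\det _).
by apply/matrixP=> i j; rewrite !mxE eq_sym.
Qed.

Lemma hadj_rc m n (M : 'M[R]_(m, n)) : hadj (map_mx rc M) = map_mx rc M^T.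
Proof. by apply/matrixP=> i j; rewrite !mxE conj_rc. Qed.

Lemma stable_psd p (A : 'M[R]_p) (Z : 'M[C]_p) : stable A -> hadj Z = Z ->
  psd (- (map_mx rc A^T *m Z + Z *m map_mx rc A)) -> psd Z.
Proof.
move=> stA hZ pS; apply: (@lyapunov_psd _ _ (map_mx rc A^T) Z _ hZ); last first.
  by rewrite hadj_rc trmxK.
move=> a; rewrite eigenvalue_root_char -map_trmx char_poly_tr -eigenvalue_root_char => /stA.
rewrite conjCc addcJ => neg; rewrite pmulr_rlt0 ?ltr0n //.
by rewrite -[0]/(rc 0) ltcR.
Qed.

(** Both [Z] and [- Z] are semidefinite, so the form vanishes and every unit vector lies in the
    kernel. *)
Lemma stable_lyapunov_inj_herm p (A : 'M[R]_p) (Z : 'M[C]_p) : stable A -> hadj Z = Z ->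
  map_mx rc A^T *m Z + Z *m map_mx rc A = 0 -> Z = 0.
Proof.
move=> stA hZ e.
have psd0 : psd (0 : 'M[C]_p) by move=> x; rewrite mulmx0 mul0mx mxE.
have pZ : psd Z by apply: (stable_psd stA hZ); rewrite e oppr0; exact: psd0.
have hN : hadj (- Z) = - Z by rewrite -scaleN1r hadjZ rmorphN1 hZ.
have pN : psd (- Z).
  by apply: (stable_psd stA hN); rewrite mulmxN mulNmx -opprD e !oppr0; exact: psd0.
apply/row_matrixP=> i; rewrite row0 rowE; apply: (psd_null hZ pZ).
have ge := pZ (delta_mx 0 i); have := pN (delta_mx 0 i).
by rewrite mulmxN mulNmx mxE oppr_ge0 => le; apply/eqP; rewrite eq_le le ge.
Qed.

(** [K + K^T] and [i (K - K^T)] are Hermitian solutions, so both vanish. *)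
Lemma stable_lyapunov_inj p (A K : 'M[R]_p) : stable A ->
  A^T *m K + K *m A = 0 -> K = 0.
Proof.
move=> stA e.
have eT : A^T *m K^T + K^T *m A = 0.
  by rewrite -[RHS]trmx0 -e linearD /= !trmx_mul trmxK addrC.
have rc0 m n (M : 'M[R]_(m, n)) : map_mx rc M = 0 -> M = 0.
  by move=> h; apply/matrixP=> i j; move/matrixP: h => /(_ i j); rewrite !mxE => - [].
have h1 : K + K^T = 0.
  apply: rc0; apply: (stable_lyapunov_inj_herm stA).
    by rewrite hadj_rc linearD /= trmxK addrC.
  by rewrite -!map_mxM -map_mxD mulmxDr mulmxDl addrACA e eT addr0 map_mx0.
have h2 : K - K^T = 0.
  apply: rc0; apply: (@scalerI _ _ 'i%C); first by rewrite eq_complex /= eqxx oner_eq0.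
  rewrite scaler0; apply: (stable_lyapunov_inj_herm stA).
    rewrite hadjZ hadj_rc linearB /= trmxK -opprB map_mxN scalerN -scaleNr.
    by congr (_ *: _); apply/eqP; rewrite eq_complex /= opprK oppr0 !eqxx.
  rewrite -scalemxAr -scalemxAl -scalerDr -!map_mxM -map_mxD mulmxBr mulmxBl addrACA.
  by rewrite -opprD e eT subrr map_mx0 scaler0.
have : K *+ 2 = 0 by rewrite -[RHS]addr0 -{1}h1 -h2 addrACA subrr addr0 mulr2n.
by move/matrixP=> h; apply/matrixP=> i j; have /eqP := h i j; rewrite mulmxnE !mxE mulrn_eq0 => /eqP.
Qed.

(** An injective operator on a finite-dimensional space is onto; the transpose of a solution is
    another one, so uniqueness makes it symmetric. *)
Lemma stable_lyapunov_solve p (A S : 'M[R]_p) : stable A -> S^T = S ->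
  exists2 K : 'M[R]_p, K^T = K & A^T *m K + K *m A = S.
Proof.
move=> stA sS; pose f := (mulmx A^T \+ mulmxr A)%R : 'M[R]_p -> 'M[R]_p.
have u : lin_mx f \in unitmx.
  rewrite -row_free_unit; apply: inj_row_free => v e.
  have := mul_vec_lin f (vec_mx v); rewrite vec_mxK e => /esym/eqP.
  rewrite mxvec_eq0 => /eqP /(stable_lyapunov_inj stA) h.
  by rewrite -[v]vec_mxK h linear0.
pose K := vec_mx (mxvec S *m invmx (lin_mx f)).
have KE : A^T *m K + K *m A = S.
  by apply: (can_inj mxvecK); rewrite -(mul_vec_lin f) vec_mxK mulmxKV.
exists K => //; apply/eqP; rewrite -subr_eq0; apply/eqP.
apply: (stable_lyapunov_inj stA).
have KTE : A^T *m K^T + K^T *m A = S.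
  by rewrite -sS -[in RHS]KE linearD /= !trmx_mul trmxK addrC.
by rewrite mulmxBr mulmxBl addrACA -opprD KE KTE subrr.
Qed.

(** * Pole separation and relative degree *)

Lemma coprime_hurwitz (d : {poly R}) : d != 0 ->
  (forall z : C, root (rho d) z -> complex.Re z < 0) -> coprimep d (d \Po (- 'X)).
Proof.
move=> d0 hd; rewrite /coprimep; apply/negPn/negP; rewrite -(size_map_poly rc) => /closed_rootP[z rz].
have dz : root (rho d) z.
  by move: rz; rewrite -!dvdp_XsubCl => /dvdp_trans; apply; rewrite dvdp_map dvdp_gcdl.
have dnz : root (rho d) (- z).
  have : root (rho (d \Po (- 'X))) z.
    by move: rz; rewrite -!dvdp_XsubCl => /dvdp_trans; apply; rewrite dvdp_map dvdp_gcdr.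
  by rewrite map_comp_poly rmorphN /= map_polyX /root horner_comp hornerN hornerX.
have := hd _ dz; have := hd _ dnz; case: z {rz dz dnz} => a b /=.
by rewrite oppr_lt0 => /lt_trans h /h; rewrite ltxx.
Qed.

(* The poles of [E P^-1] lie in the open left half plane and those of its
   paraconjugate in the right one. *)
Lemma para_skew_eq0 n (P E : 'M[{poly R}]_n) : \det P != 0 -> hurwitz P ->
  sp_right E P -> rpara P *m E + rpara E *m P = 0 -> E = 0.
Proof.
move=> d0 hP sE e; set d := \det P in d0.
pose F := E *m \adj P.
have FE : (d \Po (- 'X)) *: F + d *: rpara F = 0.
  have := congr1 (fun M => rpara (\adj P) *m M *m \adj P) e.
  rewrite mulmx0 mul0mx mulmxDr mulmxDl !mulmxA -!rparaM mul_mx_adj => <-.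
  congr (_ + _); last by rewrite -mulmxA mul_mx_adj mul_mx_scalar.
  rewrite -mulmxA -mul_scalar_mx; congr (_ *m _).
  apply/matrixP=> a b; rewrite rparaE !mxE eq_sym.
  by case: eqP => _; rewrite ?mulr1n ?mulr0n ?comp_poly0.
have F0 : F = 0.
  apply/matrixP=> i j; rewrite [RHS]mxE; apply/eqP/negPn/negP => nz.
  have : d %| (d \Po (- 'X)) * F i j.
    move/matrixP: FE => /(_ i j); rewrite [LHS]mxE [RHS]mxE [X in X + _]mxE [X in _ + X]mxE.
    by move/eqP; rewrite addr_eq0 => /eqP ->; rewrite dvdpNr dvdp_mulr.
  rewrite Gauss_dvdpr; last exact: coprime_hurwitz.
  by move/(dvdp_leq nz); rewrite leqNgt; move: (sE i j); rewrite -/d -/F => ->.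
have : F *m P = 0 by rewrite F0 mul0mx.
rewrite /F -mulmxA mul_adj_mx mul_mx_scalar => /matrixP h.
apply/matrixP=> i j; have /eqP := h i j.
by rewrite !mxE -/d mulf_eq0 (negPf d0) => /eqP.
Qed.

Lemma size_mul_sub3 (p q : {poly R}) x y : (size p < x)%N -> (size q < y)%N ->
  (size (p * q)%R <= (x + y) - 3)%N.
Proof.
move=> sp sq; have [->|nz] := eqVneq (p * q) 0; first by rewrite size_poly0.
move: nz; rewrite mulf_eq0 negb_or => /andP[pz qz]; rewrite size_mul //.
move: pz qz; rewrite -!size_poly_gt0; move: sp sq.
by move: (size p) (size q) => a b; lia.
Qed.

(** [F P1^-1] is the product of the strictly proper [F P2^-1] and [P2 P1^-1], so its relative degree
    is at least two and survives one multiplication by the variable. *)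
Lemma sp_right_shift m n (P1 P2 : 'M[{poly R}]_n) (F : 'M[{poly R}]_(m, n)) :
  \det P2 != 0 -> sp_right P2 P1 -> sp_right F P2 -> sp_right ('X *: F) P1.
Proof.
move=> d2 s21 sF i j; rewrite -scalemxAl mxE mulrC; set f := (F *m _) i j.
have [->|nz] := eqVneq f 0.
  by rewrite mul0r size_poly0 (leq_ltn_trans _ (s21 j j)).
rewrite size_mulX //.
have : (size (\det P2 * f)%R <= size (\det P2) + size (\det P1) - 3)%N.
  have -> : \det P2 * f = ((F *m \adj P2) *m (P2 *m \adj P1)) i j.
    by rewrite -mulmxA (mulmxA (\adj P2)) mul_adj_mx mul_scalar_mx -scalemxAr mxE.
  by apply: size_mulmx_leq => k; apply: size_mul_sub3; [exact: sF | exact: s21].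
rewrite size_mul //; move: d2 nz (s21 j j); rewrite -!size_poly_gt0.
by move: (size (\det P2)) (size f) (size (\det P1)) => a b c; lia.
Qed.

(** * The storage function on the state space *)

Lemma real_psd p (K : 'M[R]_p) : psd (map_mx rc K) ->
  forall x : 'cV[R]_p, 0 <= (x^T *m K *m x) 0 0.
Proof.
move=> pK x; have := pK (map_mx rc x^T).
by rewrite hadj_rc trmxK -!map_mxM mxE ler0c.
Qed.

Lemma real_psd_null p (K : 'M[R]_p) (x : 'rV[R]_p) : K^T = K -> psd (map_mx rc K) ->
  (x *m K *m x^T) 0 0 = 0 -> x *m K = 0.
Proof.
move=> sK pK x0.
have : map_mx rc x *m map_mx rc K = 0.
  apply: psd_null; [by rewrite hadj_rc sK | exact: pK |].
  by rewrite hadj_rc -!map_mxM mxE x0.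
by rewrite -map_mxM => h; apply/matrixP=> i j; move/matrixP: h => /(_ i j); rewrite !mxE => - [].
Qed.

(** After expanding both shifts, the terms in [A] collect to [A^T K + K A = - G^T G] and give
    [- bilin Q Q], while those in [B] pair [P] with [B^T K X]. *)
Lemma mul_zpe_storage n p q (P : 'M[{poly R}]_n) (X : 'M[{poly R}]_(p, n))
    (Q : 'M[{poly R}]_(q, n)) (A K : 'M[R]_p) (B : 'M[R]_(p, n)) (G : 'M[R]_(q, p)) :
  'X *: X = cst A *m X + cst B *m P -> Q = cst G *m X ->
  K^T = K -> A^T *m K + K *m A = - (G^T *m G) ->
  mul_zpe (bilin X (cst K *m X)) =
  bilin P (cst (B^T *m K) *m X) + bilin (cst (B^T *m K) *m X) P - bilin Q Q.
Proof.
move=> eX eQ sK lyap; rewrite mul_zpe_bilin scalemxAr eX mulmxDr bilinDl bilinDr (bilin_cst A) (bilin_cst B).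
have -> : bilin X (cst K *m (cst B *m P)) = bilin (cst (B^T *m K) *m X) P.
  by rewrite bilin_cst trmx_mul sK trmxK map_mxM mulmxA.
have -> : bilin Q Q = - (bilin X (cst A^T *m (cst K *m X)) + bilin X (cst K *m (cst A *m X))).
  rewrite -bilinDr !mulmxA -mulmxDl -!map_mxM -map_mxD lyap map_mxN mulNmx bilinNr opprK.
  by rewrite {1}eQ bilin_cst eQ mulmxA -map_mxM.
by rewrite opprK !map_mxM !mulmxA addrACA addrC.
Qed.

Lemma basis_stable n p (P : 'M[{poly R}]_n) (X : 'M[{poly R}]_(p, n)) A B :
  state_basis P X -> hurwitz P ->
  'X *: X = cst A *m X + cst B *m P -> stable A.
Proof.
by move=> bX hP eX a /(shift_eigenvalue bX eX) h; apply: hP; apply/eqP.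
Qed.

Lemma storage_solution n p q (P P2 : 'M[{poly R}]_n) (X : 'M[{poly R}]_(p, n))
    (Q : 'M[{poly R}]_(q, n)) :
  \det P != 0 -> state_basis P X -> hurwitz P -> sp_right P2 P -> sp_right Q P ->
  rpara P *m P2 + rpara P2 *m P = rpara Q *m Q ->
  exists (A K : 'M[R]_p) (B : 'M[R]_(p, n)),
    [/\ 'X *: X = cst A *m X + cst B *m P, K^T = K, psd (map_mx rc K),
        P2 = cst (B^T *m K) *m X
      & mul_zpe (bilin X (cst K *m X)) = bilin P P2 + bilin P2 P - bilin Q Q].
Proof.
move=> d0 bX hP s2 sQ spec.
have [A [B eX]] := basis_shift d0 bX.
have [G eQ] := basis_coord bX sQ.
have stA := basis_stable bX hP eX.
have [|K sK lyap] := @stable_lyapunov_solve _ A (- (G^T *m G)) stA.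
  by rewrite linearN /= trmx_mul trmxK.
have zpe := mul_zpe_storage eX eQ sK lyap.
(* At [zeta = - eta] the derivative form vanishes, so [Y - P2] is para-skew as well as strictly
   proper over [P], hence zero. *)
have e2 : P2 = cst (B^T *m K) *m X.
  apply/esym/eqP; rewrite -subr_eq0; apply/eqP; set Y := cst (B^T *m K) *m X in zpe *.
  have sY : sp_right Y P by apply: sp_right_cst => //; exact: (basis_sp bX).
  apply: (para_skew_eq0 d0 hP); first exact: (sp_rightD sY (sp_rightN s2)).
  have := congr1 (@diag_sub R n) zpe; rewrite diag_sub_mul_zpe -bilinNr !diag_subD !diag_sub_bilin.
  rewrite mulmxN -spec => e3.
  have -> : rpara (Y - P2) = rpara Y - rpara P2.
    by apply/matrixP=> i j; rewrite !(rparaE, mxE) rmorphB.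
  by rewrite mulmxBr mulmxBl addrACA -opprD -e3.
exists A, K, B; split => //; last by rewrite {1 2}e2.
apply: (stable_psd stA); first by rewrite hadj_rc sK.
rewrite -!map_mxM -map_mxD lyap map_mxN opprK map_mxM => x.
have := form_ge0 (x *m map_mx rc G^T).
by rewrite hadjM hadj_rc trmxK !mulmxA.
Qed.

(** A vector [u] killed by the gain makes [u B^T] isotropic for [K], so [u B^T K = 0] and
    [u P2 = 0]; nonsingularity of [P2] gives [u = 0]. *)
Lemma high_frequency_gain_unit n p (P2 : 'M[{poly R}]_n) (X : 'M[{poly R}]_(p, n))
    (K : 'M[R]_p) (B : 'M[R]_(p, n)) :
  \det P2 != 0 -> K^T = K -> psd (map_mx rc K) -> P2 = cst (B^T *m K) *m X ->
  B^T *m K *m B \in unitmx.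
Proof.
move=> d2 sK pK e2; rewrite -row_free_unit; apply: inj_row_free => u uG.
have uBK : u *m B^T *m K = 0.
  apply: real_psd_null => //; rewrite trmx_mul trmxK.
  by rewrite !mulmxA in uG *; rewrite uG mul0mx mxE.
have : cst u *m P2 = 0 by rewrite e2 mulmxA -map_mxM mulmxA uBK map_mx0 mul0mx.
move/(mulmxI_det d2) => h; apply/matrixP=> i j; move/matrixP: h => /(_ i j).
by rewrite !mxE => /eqP; rewrite polyC_eq0 => /eqP.
Qed.

(* [G] is the limit at infinity of [xi P2(xi) P(xi)^-1]. *)
Lemma degree_drop n p (P P2 : 'M[{poly R}]_n) (X : 'M[{poly R}]_(p, n)) (N : 'M[R]_(n, p))
    (G : 'M[R]_n) :
  \det P != 0 -> \det P2 != 0 -> sp_right P2 P -> sp_right X P -> G \in unitmx ->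
  'X *: P2 = cst N *m X + cst G *m P ->
  ((size (\det P)).-1 <= (size (\det P2)).-1 + n)%N.
Proof.
move=> d1 d2 s21 sX uG e; set n1 := (size (\det P)).-1.
have dpos : (0 < size (\det P))%N by rewrite size_poly_gt0.
have [->//|n1pos] := posnP n1.
pose H := P2 *m \adj P.
have sH i j : (size (H i j) <= (n1.-1 + 0).+1)%N.
  by rewrite addn0 prednK // -ltnS /n1 prednK //; exact: s21.
have HE : \matrix_(i, j) (H i j)`_(n1.-1 + 0) = lead_coef (\det P) *: G.
  apply/matrixP=> i j; rewrite [LHS]mxE [RHS]mxE addn0.
  have h : 'X *: H = cst N *m X *m \adj P + \det P *: cst G.
    by rewrite /H scalemxAl e mulmxDl -(mulmxA (cst G)) mul_mx_adj mul_mx_scalar.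
  have hij : 'X * H i j = (cst N *m X *m \adj P) i j + \det P * (G i j)%:P.
    transitivity (('X *: H) i j); first by rewrite [RHS]mxE.
    by rewrite h [LHS]mxE; congr (_ + _); rewrite [LHS]mxE [in LHS]mxE.
  have sN : (size ((cst N *m X *m \adj P) i j)%R <= n1)%N.
    by rewrite -ltnS /n1 prednK //; exact: (sp_right_cst N d1 sX).
  have := congr1 (fun p : {poly R} => p`_n1) hij.
  by rewrite coefXM gtn_eqF // coefD coefMC (nth_default 0 sN) add0r.
have dH : (\det H)`_(n * n1.-1) != 0.
  have := coef_det_top (a := fun _ => n1.-1) (b := fun _ => 0%N) sH.
  rewrite HE !sum_nat_const card_ord muln0 addn0 => ->.
  rewrite detZ mulf_neq0 ?expf_neq0 ?lead_coef_eq0 //.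
  by rewrite -unitfE -unitmxE.
have szH : (n * n1.-1 < size (\det H))%N.
  by rewrite ltnNge; apply: contra dH => h; rewrite nth_default.
have hnz : \det H != 0 by rewrite -size_poly_gt0 (leq_ltn_trans _ szH).
(* The left side has degree at least [n (n1 - 1) + n1], the right side [deg det P2 + n n1]. *)
have : \det H * \det P = \det P2 * \det P ^+ n.
  by rewrite -det_mulmx /H -mulmxA mul_adj_mx mul_mx_scalar detZ mulrC.
move/(congr1 (fun p : {poly R} => size p)).
have ePn : size (\det P ^+ n) = (n1 * n).+1.
  by rewrite -size_exp prednK // size_poly_gt0 expf_neq0.
rewrite !size_mul // ?expf_neq0 // ePn -[size (\det P)](prednK dpos) -/n1.
move: szH d2; rewrite -size_poly_gt0.
move: (size (\det H)) (size (\det P2)) n1pos => a b.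
case: n1 {sH HE dH ePn} => // c _; case: a => // a; case: b => // b.
rewrite !addnS !addSn /= => szH _ [e2].
by move: szH e2; rewrite mulSn mulnC; lia.
Qed.

Lemma storage_matrix n n2 m q (R1 R2 : 'M[{poly R}]_n) (X2 : 'M[{poly R}]_(n2, n))
    (X1' : 'M[{poly R}]_(m, n)) (Pi : 'M[R]_(m, n2)) (Q : 'M[{poly R}]_(q, n)) :
  \det R1 != 0 -> \det R2 != 0 -> sp_right R2 R1 ->
  n2 = (size (\det R2)).-1 -> (n2 + m)%N = (size (\det R1)).-1 ->
  state_basis R2 X2 -> state_basis R1 (col_mx X2 X1') ->
  rmod R2 X1' = cst Pi *m X2 -> hurwitz R1 -> sp_right Q R1 ->
  rpara R1 *m R2 + rpara R2 *m R1 = rpara Q *m Q ->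
  exists K : 'M[R]_(n2 + m),
    [/\ K^T = K, forall x : 'cV[R]_(n2 + m), 0 <= (x^T *m K *m x) 0 0,
        mul_zpe (bilin (col_mx X2 X1') (cst K *m col_mx X2 X1')) =
          bilin R1 R2 + bilin R2 R1 - bilin Q Q
      & (col_mx 1%:M Pi)^T *m K *m col_mx 0 1%:M = 0].
Proof.
move=> d1 d2 s21 e2 e1 b2 b1 eX' h1 sQ spec; set X1 := col_mx X2 X1' in b1 *.
have [A [K [B [eX sK pK eR2 zpe]]]] := storage_solution d1 b1 h1 s21 sQ spec.
exists K; split => //; first exact: real_psd.
pose Cc := B^T *m K; rewrite -/Cc in eR2.
have uG := high_frequency_gain_unit d2 sK pK eR2; rewrite -/Cc in uG.
have eXR2 : 'X *: R2 = cst (Cc *m A) *m X1 + cst (Cc *m B) *m R1.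
  by rewrite {1}eR2 scalemxAr eX mulmxDr !mulmxA -!map_mxM.
have mn : (m <= n)%N.
  have := degree_drop d1 d2 s21 (basis_sp b1) uG eXR2.
  by rewrite -e1 -e2 leq_add2l.
(* [xi X2 R1^-1] is still strictly proper, so its polynomial part, the [X2] block of [B], is
   zero. *)
have B20 : usubmx B = 0.
  have [N eN] := basis_coord b1 (sp_right_shift d2 s21 (basis_sp b2)).
  have eU : 'X *: X2 = cst (usubmx A) *m X1 + cst (usubmx B) *m R1.
    have -> : 'X *: X2 = usubmx ('X *: X1) by rewrite scale_col_mx col_mxKu.
    by rewrite eX linearD /= -!mul_usub_mx -!map_usubmx.
  suff [] : usubmx A - N = 0 /\ usubmx B = 0 by [].
  by apply: (basis_unique d1 b1); rewrite map_mxB mulmxBl -eN addrAC -eU subrr.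
have BE : B = col_mx 0 1%:M *m dsubmx B.
  by rewrite mul_col_mx mul0mx mul1mx -{1}[B]vsubmxK B20.
(* The invertible gain factors through this block, so its rank is at least [n], while it has only
   [m <= n] rows. *)
have free : row_free (dsubmx B).
  rewrite /row_free eqn_leq rank_leq_row (leq_trans mn) //.
  rewrite -[X in (X <= _)%N](mxrank_unit uG) {1}BE mulmxA; exact: mxrankM_maxr.
(* Substituting [X1' = Pi X2 + W R2] into [R2 = C X1] writes a polynomial multiple of [R2] as a
   constant combination of [X2]; strict properness makes both sides vanish. *)
have CE : Cc *m col_mx 1%:M Pi = 0.
  pose W := map_mx (fun e => e %/ \det R2) (X1' *m \adj R2).
  have eX1' : X1' = cst Pi *m X2 + W *m R2 by rewrite -eX' -rmodE.
  have eR : (1%:M - cst (rsubmx Cc) *m W) *m R2 = cst (lsubmx Cc + rsubmx Cc *m Pi) *m X2.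
    rewrite mulmxBl mul1mx {1}eR2 /X1 {1}eX1' -{1}[Cc]hsubmxK map_row_mx mul_row_col.
    rewrite mulmxDr map_mxD mulmxDl map_mxM !mulmxA.
    by rewrite addrA addrK.
  have W1 : 1%:M - cst (rsubmx Cc) *m W = 0.
    by apply: (sp_right_mulP d2); rewrite eR; apply: sp_right_cst => //; exact: (basis_sp b2).
  rewrite -[Cc]hsubmxK mul_row_col mulmx1; apply: (basis_free b2).
  by rewrite -eR W1 mul0mx.
(* [col(0, 1)] is [B] times a right inverse of its lower block, and [K B = C^T], so the claim is the
   transpose of [CE]. *)
have -> : (col_mx 1%:M Pi)^T *m K *m col_mx 0 1%:M =
   (col_mx 1%:M Pi)^T *m (K *m B) *m pinvmx (dsubmx B).
  transitivity ((col_mx 1%:M Pi)^T *m K *m col_mx 0 1%:M *m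
    (dsubmx B *m pinvmx (dsubmx B))); first by rewrite (mulmxVp free) mulmx1.
  by rewrite mulmxA; congr (_ *m _); rewrite -!mulmxA -BE.
have -> : K *m B = Cc^T by rewrite trmx_mul trmxK sK.
by rewrite -trmx_mul CE trmx0 mul0mx.
Qed.

(** * Trajectories and quadratic differential forms *)

(** The linear functional sending the [k]-th power of the variable to [s k]; at the jet of [f] it
    gives [p(d/dt) f]. *)
Definition pev (s : nat -> R) (p : {poly R}) : R := \sum_(k < size p) p`_k * s k.

Lemma pev_widen s (p : {poly R}) N : (size p <= N)%N -> pev s p = \sum_(k < N) p`_k * s k.
Proof.
move=> le; rewrite /pev (big_ord_widen N (fun k => p`_k * s k)) // big_mkcond /=.
apply: eq_bigr => k _; case: ltnP => // /(nth_default 0) ->.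
by rewrite mul0r.
Qed.

Lemma pevD s : {morph pev s : p q / p + q}.
Proof.
move=> p q; pose N := maxn (size p) (size q).
rewrite (@pev_widen s p N) ?leq_maxl // (@pev_widen s q N) ?leq_maxr //.
rewrite (@pev_widen s _ N) ?size_polyD // -big_split /=.
by apply: eq_bigr => k _; rewrite coefD mulrDl.
Qed.

Lemma pev0 s : pev s 0 = 0.
Proof. by rewrite /pev size_poly0 big_ord0. Qed.

Lemma pev_sum s (I : finType) (F : I -> {poly R}) : pev s (\sum_i F i) = \sum_i pev s (F i).
Proof. exact: (big_morph _ (pevD s) (pev0 s)). Qed.

Lemma pevZ s c p : pev s (c%:P * p) = c * pev s p.
Proof.
rewrite (@pev_widen s _ (size p)); last by rewrite mul_polyC size_scale_leq.
by rewrite /pev mulr_sumr; apply: eq_bigr => k _; rewrite coefCM mulrA.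
Qed.

Lemma pevXM s p : pev s ('X * p) = pev (fun k => s k.+1) p.
Proof.
rewrite (@pev_widen s _ (size p).+1); last first.
  by apply: (leq_trans (size_polyMleq _ _)); rewrite size_polyX.
rewrite big_ord_recl coefXM /= mul0r add0r.
by apply: eq_bigr => k _; rewrite coefXM.
Qed.

Definition jet (f : R -> R) (t : R) : nat -> R := fun k => derive1n k f t.

Lemma diffopE m n (P : 'M[{poly R}]_(m, n)) (v : traj R n) i t :
  diffop P v i t = \sum_j pev (jet (v j) t) (P i j).
Proof. by []. Qed.

Lemma diffop_mulmx m n p (M : 'M[{poly R}]_(m, n)) (P : 'M[{poly R}]_(n, p)) v i t :
  diffop (M *m P) v i t = \sum_r \sum_j pev (jet (v j) t) (M i r * P r j).
Proof.
rewrite diffopE exchange_big; apply: eq_bigr => j _.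
by rewrite mxE pev_sum.
Qed.

Lemma diffopD m n (M P : 'M[{poly R}]_(m, n)) v i t :
  diffop (M + P) v i t = diffop M v i t + diffop P v i t.
Proof. by rewrite !diffopE -big_split; apply: eq_bigr => j _; rewrite mxE pevD. Qed.

Lemma diffop_cst m n p (N : 'M[R]_(m, n)) (P : 'M[{poly R}]_(n, p)) v i t :
  diffop (cst N *m P) v i t = \sum_r N i r * diffop P v r t.
Proof.
rewrite diffop_mulmx; apply: eq_bigr => r _; rewrite diffopE mulr_sumr.
by apply: eq_bigr => j _; rewrite mxE pevZ.
Qed.

Lemma is_derive_jet (f : R -> R) k (t : R) : smooth f ->
  is_derive t (1 : R) (derive1n k f) (derive1n k.+1 f t).
Proof.
move=> sf; apply: DeriveDef; first exact: sf.
by rewrite derive1nS derive1E.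
Qed.

Lemma derive_pev_sum n (v : traj R n) (F : 'I_n -> {poly R}) (t : R) : (forall j, smooth (v j)) ->
  is_derive t (1 : R) (fun t => \sum_j pev (jet (v j) t) (F j))
    (\sum_j pev (jet (v j) t) ('X * F j)).
Proof.
move=> sv.
have -> : (fun t => \sum_j pev (jet (v j) t) (F j)) = \sum_j (fun t => pev (jet (v j) t) (F j)).
  by apply/funext => u; rewrite fct_sumE.
apply: is_derive_sum => j; rewrite pevXM.
have -> : (fun t => pev (jet (v j) t) (F j)) =
    \sum_(k < size (F j)) ((F j)`_k \*: derive1n k (v j)).
  by apply/funext => u; rewrite fct_sumE.
apply: is_derive_sum => k; apply: is_deriveZ; exact: is_derive_jet.
Qed.

(** Horner induction on the multiplier: a factor of the variable differentiates a function already
    known to vanish identically, and a constant adds a multiple of [P v], which is zero. *)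
Lemma in_beh_mul m n p (M : 'M[{poly R}]_(m, n)) (P : 'M[{poly R}]_(n, p)) v i t :
  in_beh P v -> diffop (M *m P) v i t = 0.
Proof.
move=> [sv Pv]; rewrite diffop_mulmx big1 // => r _.
elim/poly_ind: (M i r) t => [|q c IH] t.
  by rewrite big1 // => j _; rewrite mul0r pev0.
under eq_bigr => j _ do rewrite mulrDl pevD [q * 'X]mulrC -mulrA pevZ.
rewrite big_split /= -mulr_sumr -[X in _ + _ * X]diffopE Pv mulr0 addr0.
have := derive_pev_sum (fun j => q * P r j) t sv.
have -> : (fun t => \sum_j pev (jet (v j) t) (q * P r j)) = functions.cst 0.
  by apply/funext => u; exact: IH.
by move=> h; have := @derive_val _ _ _ _ _ _ _ h; rewrite derive_cst => <-.
Qed.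

Lemma beh_rmod m n (P : 'M[{poly R}]_n) (M : 'M[{poly R}]_(m, n)) v i t :
  in_beh P v -> diffop (rmod P M) v i t = diffop M v i t.
Proof. by move=> bv; rewrite [in RHS](rmodE P M) diffopD (in_beh_mul _ _ _ bv) addr0. Qed.

Lemma beh_rmodX m n (P : 'M[{poly R}]_n) (M : 'M[{poly R}]_(m, n)) v i t :
  in_beh P v -> diffop ('X *: rmod P M) v i t = diffop ('X *: M) v i t.
Proof.
move=> bv; pose W := map_mx (fun e => e %/ \det P) (M *m \adj P).
have e : 'X *: M = 'X *: rmod P M + ('X *: W) *m P.
  by rewrite -scalemxAl -scalerDr -rmodE.
by rewrite e diffopD (in_beh_mul _ _ _ bv) addr0.
Qed.

Lemma qdfE n (Psi : 'M[{poly {poly R}}]_n) v t : qdf Psi v t =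
  \sum_i \sum_j \sum_(h < size (Psi i j)) jet (v i) t h * pev (jet (v j) t) (Psi i j)`_h.
Proof.
apply: eq_bigr => i _; apply: eq_bigr => j _; apply: eq_bigr => h _.
by rewrite /pev mulr_sumr; apply: eq_bigr => k _; rewrite mulrCA mulrA.
Qed.

Definition pev2 (s1 s2 : nat -> R) (p : {poly {poly R}}) : R :=
  \sum_(h < size p) s1 h * pev s2 p`_h.

Lemma pev2_widen s1 s2 (p : {poly {poly R}}) N : (size p <= N)%N ->
  pev2 s1 s2 p = \sum_(h < N) s1 h * pev s2 p`_h.
Proof.
move=> le; rewrite /pev2 (big_ord_widen N (fun h => s1 h * pev s2 p`_h)) // big_mkcond /=.
apply: eq_bigr => k _; case: ltnP => // /(nth_default 0) ->.
by rewrite pev0 mulr0.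
Qed.

Lemma pev2D s1 s2 : {morph pev2 s1 s2 : p q / p + q}.
Proof.
move=> p q; pose N := maxn (size p) (size q).
rewrite (@pev2_widen _ _ p N) ?leq_maxl // (@pev2_widen _ _ q N) ?leq_maxr //.
rewrite (@pev2_widen _ _ _ N) ?size_polyD // -big_split /=.
by apply: eq_bigr => k _; rewrite coefD pevD mulrDr.
Qed.

Lemma pev20 s1 s2 : pev2 s1 s2 0 = 0.
Proof. by rewrite /pev2 size_poly0 big_ord0. Qed.

Lemma pev2_tensor s1 s2 (p q : {poly R}) :
  pev2 s1 s2 (map_poly polyC p * q%:P) = pev s1 p * pev s2 q.
Proof.
rewrite (@pev2_widen _ _ _ (size p)); last first.
  rewrite mulrC mul_polyC; apply: (leq_trans (size_scale_leq _ _)).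
  by rewrite size_poly.
rewrite /pev mulr_suml; apply: eq_bigr => h _.
by rewrite coefMC coef_map /= -/(pev s2 _) pevZ mulrCA mulrA.
Qed.

Lemma qdf_pev2 n (Psi : 'M[{poly {poly R}}]_n) v t :
  qdf Psi v t = \sum_i \sum_j pev2 (jet (v i) t) (jet (v j) t) (Psi i j).
Proof. by rewrite qdfE. Qed.

Lemma qdfD n (P Q : 'M[{poly {poly R}}]_n) v t : qdf (P + Q) v t = qdf P v t + qdf Q v t.
Proof.
rewrite !qdf_pev2 -big_split; apply: eq_bigr => i _; rewrite -big_split.
by apply: eq_bigr => j _; rewrite mxE pev2D.
Qed.

Lemma qdf_bilin p n (M L : 'M[{poly R}]_(p, n)) v t :
  qdf (bilin M L) v t = \sum_r diffop M v r t * diffop L v r t.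
Proof.
rewrite qdf_pev2.
have -> : \sum_i \sum_j pev2 (jet (v i) t) (jet (v j) t) (bilin M L i j) =
    \sum_i \sum_j \sum_r pev (jet (v i) t) (M r i) * pev (jet (v j) t) (L r j).
  apply: eq_bigr => i _; apply: eq_bigr => j _; rewrite mxE.
  rewrite (big_morph _ (@pev2D _ _) (@pev20 _ _)).
  by apply: eq_bigr => r _; rewrite pev2_tensor.
under eq_bigr do rewrite exchange_big.
rewrite exchange_big; apply: eq_bigr => r _; rewrite !diffopE mulr_suml.
by apply: eq_bigr => i _; rewrite mulr_sumr.
Qed.

(** * Observability of both modes through [Q] *)

Lemma annihilator_mul (f : R -> R) (p q : {poly R}) : smooth f ->
  (forall t, pev (jet f t) p = 0) -> forall t, pev (jet f t) (q * p) = 0.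
Proof.
move=> sf h t; have b : in_beh (p%:M : 'M[{poly R}]_1) (fun _ : 'I_1 => f).
  by split=> // i u; rewrite diffopE big_ord1 ord1 mxE eqxx h.
have := in_beh_mul (q%:M : 'M[{poly R}]_1) 0 t b.
by rewrite diffopE big_ord1 -scalar_mxM mxE eqxx.
Qed.

(* Euclidean descent in the ideal of annihilators of [v j]: at a root of an annihilator
   some maximal minor of [col(P, Q)], which also annihilates [v j], does not vanish. *)
Lemma beh_eq0 n q (P : 'M[{poly R}]_n) (Q : 'M[{poly R}]_(q, n)) v :
  \det P != 0 -> in_beh P v -> (forall i t, diffop Q v i t = 0) ->
  (forall lam, \rank (col_mx (evalCmx P lam) (evalCmx Q lam)) = n) ->
  forall j t, v j t = 0.
Proof.
move=> d0 [sv Pv] Qv rk j.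
pose W := col_mx P Q.
have Wv i t : diffop W v i t = 0.
  rewrite -(splitK i); case: (fintype.split i) => k /=.
    by rewrite diffopE; under eq_bigr do rewrite col_mxEu; exact: Pv.
  by rewrite diffopE; under eq_bigr do rewrite col_mxEd; exact: Qv.
(* Multiplying by the adjugate isolates the component [v j]. *)
have ann (S : 'M[{poly R}]_n) : (forall i t, diffop S v i t = 0) ->
    forall t, pev (jet (v j) t) (\det S) = 0.
  move=> Sv t; have := in_beh_mul (\adj S) j t (conj sv Sv).
  rewrite mul_adj_mx diffopE (bigD1 j) //= big1 ?addr0 => [|l nl].
    by rewrite mxE eqxx.
  by rewrite mxE eq_sym (negPf nl) pev0.
suff main N (p : {poly R}) : (size p <= N)%N -> p != 0 ->
    (forall t, pev (jet (v j) t) p = 0) -> forall t, v j t = 0.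
  exact: (main _ _ (leqnn _) d0 (ann P Pv)).
elim: N p => [|N IH] p; first by rewrite leqn0 size_poly_eq0 => ->.
move=> sN nz pv; have [s1|ns1] := eqVneq (size p) 1%N.
  move=> t; move: nz; rewrite (size1_polyC (eq_leq s1)) polyC_eq0 => nz.
  have := pv t; rewrite /pev s1 big_ord1 => /eqP.
  by rewrite mulf_eq0 (negPf nz) => /eqP.
have : size (rho p) != 1%N by rewrite size_map_poly.
case/closed_rootP => z rz.
have full : row_full (evalCmx W z).
  by rewrite /row_full /W /evalCmx map_col_mx; apply/eqP; exact: rk.
pose S := rowsub (fullrankfun full) W.
have Sz : evalC (\det S) z != 0.
  rewrite -det_evalCmx -unitfE -unitmxE.
  have -> : evalCmx S z = rowsub (fullrankfun full) (evalCmx W z).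
    by apply/matrixP=> a b; rewrite !mxE.
  exact: fullrowsub_unit.
have Sv i t : diffop S v i t = 0.
  by rewrite diffopE; under eq_bigr do rewrite mxE; exact: Wv.
have Snz : \det S != 0.
  by apply: contraNneq Sz => ->; rewrite /evalC rmorph0 horner0.
have [_ _ bez] := egcdpP nz Snz; set e := egcdp _ _ in bez.
apply: (IH (e.1 * p + e.2 * \det S)).
- rewrite -(eqp_size bez) -ltnS (leq_trans _ sN) // ltn_neqAle dvdp_leq ?dvdp_gcdl // andbT.
  (* If the degree did not drop, [p] would divide [\det S], which does not vanish at the root [z] of
     [p]. *)
  apply: contraNneq Sz => sz.
  have : gcdp p (\det S) %= p by rewrite -dvdp_size_eqp ?dvdp_gcdl //; apply/eqP.
  rewrite /eqp => /andP[_ pg].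
  have /(dvdpP _ _)[c ->] : p %| \det S := dvdp_trans pg (dvdp_gcdr _ _).
  by rewrite /evalC rmorphM hornerM (rootP rz) mulr0.
- by rewrite -size_poly_gt0 -(eqp_size bez) size_poly_gt0 gcdp_eq0 negb_and nz.
- move=> t; rewrite pevD (annihilator_mul _ (sv j) pv).
  by rewrite (annihilator_mul _ (sv j) (ann S Sv)) addr0.
Qed.

Lemma rank_col_full n q (P : 'M[C]_n) (Q : 'M[C]_(q, n)) :
  (forall u : 'cV[C]_n, P *m u = 0 -> Q *m u = 0 -> u = 0) -> \rank (col_mx P Q) = n.
Proof.
move=> h; rewrite -mxrank_tr; apply/eqP; apply: inj_row_free => u e.
have {}e : col_mx P Q *m u^T = 0 by rewrite -[LHS]trmxK trmx_mul trmxK e trmx0.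
move: e; rewrite mul_col_mx -[0]vsubmxK => /eq_col_mx[e1 e2].
apply: (can_inj (@trmxK _ _ _)); rewrite trmx0; apply: h.
  by rewrite e1 linear0.
by rewrite e2 linear0.
Qed.

(* At a common zero [u] of [R2] and [Q] the factorization leaves
   [R2(-lam)^T R1(lam) u = 0], and [R2(-lam)] is invertible. *)
Lemma rank_second_mode n q (R1 R2 : 'M[{poly R}]_n) (Q : 'M[{poly R}]_(q, n)) :
  hurwitz R2 -> rpara R1 *m R2 + rpara R2 *m R1 = rpara Q *m Q ->
  (forall lam, \rank (col_mx (evalCmx R1 lam) (evalCmx Q lam)) = n) ->
  forall lam, \rank (col_mx (evalCmx R2 lam) (evalCmx Q lam)) = n.
Proof.
move=> h2 spec rk z; case: (lerP 0 (complex.Re z)) => [pos|neg]; apply: rank_col_full => u e2 eQ.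
  by rewrite -[u](mulKmx (hurwitz_unit h2 pos)) e2 mulmx0.
have : evalCmx (rpara R2) z *m (evalCmx R1 z *m u) = 0.
  have := congr1 (fun M => evalCmx M z *m u) spec.
  rewrite /= [evalCmx (_ + _) z](_ : _ = evalCmx (rpara R1 *m R2) z + evalCmx (rpara R2 *m R1) z).
    by rewrite !evalCmxM mulmxDl -!mulmxA e2 eQ !mulmx0 add0r.
  by apply/matrixP=> i j; rewrite !mxE /evalC rmorphD hornerD.
have -> : evalCmx (rpara R2) z = (evalCmx R2 (- z))^T.
  apply/matrixP=> i j; rewrite !mxE /evalC map_comp_poly rmorphN /= map_polyX.
  by rewrite horner_comp hornerN hornerX.
have u2 : (evalCmx R2 (- z))^T \in unitmx.
  by rewrite unitmx_tr hurwitz_unit //; case: z neg {e2 eQ} => a b /= /ltW; rewrite oppr_ge0.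
move/(congr1 (mulmx (invmx (evalCmx R2 (- z))^T))); rewrite mulKmx // mulmx0 => e1.
have /eqP full := rk z.
have : row_free (col_mx (evalCmx R1 z) (evalCmx Q z))^T by rewrite /row_free mxrank_tr.
move/row_freeP => [D eD].
have e0 : u^T *m (col_mx (evalCmx R1 z) (evalCmx Q z))^T = 0.
  by rewrite -trmx_mul mul_col_mx e1 eQ col_mx0 trmx0.
apply: (can_inj (@trmxK _ _ _)); rewrite trmx0.
by rewrite -[u^T]mulmx1 -eD mulmxA e0 mul0mx.
Qed.

Lemma rmod_id m n (P : 'M[{poly R}]_n) (F : 'M[{poly R}]_(m, n)) : sp_right F P -> rmod P F = F.
Proof.
move=> sF; rewrite /rmod; set W := map_mx _ _.
have -> : W = 0 by apply/matrixP=> i j; rewrite [LHS]mxE [RHS]mxE divp_small.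
by rewrite mul0mx subr0.
Qed.

(** * States, resets and the Lyapunov conditions *)

Definition state p n (X : 'M[{poly R}]_(p, n)) (v : traj R n) (t : R) : 'cV[R]_p :=
  \col_r diffop X v r t.

Lemma qdf_state p n (X : 'M[{poly R}]_(p, n)) (K : 'M[R]_p) v t :
  qdf (bilin X (cst K *m X)) v t = ((state X v t)^T *m K *m state X v t) 0 0.
Proof.
rewrite qdf_bilin -mulmxA mxE; apply: eq_bigr => r _; rewrite !mxE; congr (_ * _).
by rewrite diffop_cst; apply: eq_bigr => l _; rewrite mxE.
Qed.

Lemma state_col p q n (X : 'M[{poly R}]_(p, n)) (Y : 'M[{poly R}]_(q, n)) v t :
  state (col_mx X Y) v t = col_mx (state X v t) (state Y v t).
Proof.
apply/matrixP=> i j; rewrite mxE diffopE -(splitK i); case: (fintype.split i) => k /=.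
  by rewrite col_mxEu mxE diffopE; apply: eq_bigr => l _; rewrite col_mxEu.
by rewrite col_mxEd mxE diffopE; apply: eq_bigr => l _; rewrite col_mxEd.
Qed.

Lemma state_cst p q n (N : 'M[R]_(q, p)) (X : 'M[{poly R}]_(p, n)) v t :
  state (cst N *m X) v t = N *m state X v t.
Proof.
by apply/matrixP=> i j; rewrite !mxE diffop_cst; apply: eq_bigr => l _; rewrite mxE.
Qed.

(** [(a, b)] is [(a, Pi a)] plus [(0, b - Pi a)]; the summands are [K]-orthogonal, so the form is
    additive on them and the second term is nonnegative. *)
Lemma form_split p q (K : 'M[R]_(p + q)) (Pi : 'M[R]_(q, p)) (a : 'cV[R]_p) (b : 'cV[R]_q) :
  K^T = K -> (forall x : 'cV[R]_(p + q), 0 <= (x^T *m K *m x) 0 0) ->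
  (col_mx 1%:M Pi)^T *m K *m col_mx 0 1%:M = 0 ->
  ((col_mx a (Pi *m a))^T *m K *m col_mx a (Pi *m a)) 0 0 <=
  ((col_mx a b)^T *m K *m col_mx a b) 0 0.
Proof.
move=> sK pK cross; set x := col_mx a (Pi *m a); pose y := b - Pi *m a.
have xE : x = col_mx 1%:M Pi *m a by rewrite mul_col_mx mul1mx.
have -> : col_mx a b = x + col_mx 0 1%:M *m y.
  by rewrite mul_col_mx mul0mx mul1mx add_col_mx addr0 addrC subrK.
set z := _ *m y.
have xz : x^T *m K *m z = 0.
  transitivity (a^T *m ((col_mx 1%:M Pi)^T *m K *m col_mx 0 1%:M) *m y).
    by rewrite xE trmx_mul /z !mulmxA.
  by rewrite cross mulmx0 mul0mx.
have zx : z^T *m K *m x = 0.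
  apply: (can_inj (@trmxK _ _ _)); rewrite (trmx_mul (z^T *m K)) (trmx_mul z^T) trmxK sK.
  by rewrite mulmxA xz trmx0.
have -> : (x + z)^T = x^T + z^T by rewrite linearD.
rewrite !mulmxDl !mulmxDr xz zx addr0 add0r [X in _ <= X]mxE lerDl.
exact: pK.
Qed.

Section Switched.
Variables (n n2 m q : nat) (R1 R2 : 'M[{poly R}]_n) (X2 : 'M[{poly R}]_(n2, n)).
Variables (X1' : 'M[{poly R}]_(m, n)) (Pi : 'M[R]_(m, n2)) (Q : 'M[{poly R}]_(q, n)).
Variable K : 'M[R]_(n2 + m).
Local Notation X1 := (col_mx X2 X1').
Local Notation Psi1 := (bilin X1 (cst K *m X1)).
Hypotheses (d1 : \det R1 != 0) (d2 : \det R2 != 0) (h2 : hurwitz R2).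
Hypothesis eX : rmod R2 X1' = cst Pi *m X2.
Hypothesis spec : rpara R1 *m R2 + rpara R2 *m R1 = rpara Q *m Q.
Hypothesis rk : forall lam, \rank (col_mx (evalCmx R1 lam) (evalCmx Q lam)) = n.
Hypotheses (sK : K^T = K) (pK : forall x : 'cV[R]_(n2 + m), 0 <= (x^T *m K *m x) 0 0).
Hypothesis zpe : mul_zpe Psi1 = bilin R1 R2 + bilin R2 R1 - bilin Q Q.
Hypothesis cross : (col_mx 1%:M Pi)^T *m K *m col_mx 0 1%:M = 0.

(** Every mixed term has a factor [R1 v] or [R2 v], so along either mode only the square of [Q v]
    remains. *)
Lemma qdf_dissipation v t :
  (forall i, diffop R1 v i t = 0) \/ (forall i, diffop R2 v i t = 0) ->
  qdf (mul_zpe Psi1) v t = - \sum_r diffop Q v r t ^+ 2.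
Proof.
move=> h; rewrite zpe -bilinNr !qdfD !qdf_bilin.
have -> : \sum_r diffop R1 v r t * diffop R2 v r t = 0.
  by rewrite big1 // => r _; case: h => ->; rewrite ?mulr0 ?mul0r.
have -> : \sum_r diffop R2 v r t * diffop R1 v r t = 0.
  by rewrite big1 // => r _; case: h => ->; rewrite ?mulr0 ?mul0r.
rewrite !add0r -sumrN; apply: eq_bigr => r _.
have -> : - Q = cst (- 1%:M) *m Q.
  by rewrite map_mxN map_mx1 mulNmx mul1mx.
rewrite diffop_cst (bigD1 r) //= big1 ?addr0 => [|l nl].
  by rewrite !mxE eqxx mulN1r mulrN expr2.
by rewrite !mxE eq_sym (negPf nl) oppr0 mul0r.
Qed.

Lemma state_second_mode v t : in_beh R2 v ->
  state X1 v t = col_mx (state X2 v t) (Pi *m state X2 v t).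
Proof.
move=> bv; rewrite state_col -state_cst -eX; congr col_mx.
by apply/matrixP=> i j; rewrite !mxE beh_rmod.
Qed.

Lemma lyapunov_switched Psi2 : qdf_mod R2 Psi1 Psi2 ->
  multiple_lyapunov (fun k => match k with Mode1 => R1 | Mode2 => R2 end)
    (col_mx X2 (cst Pi *m X2)) X1 X2 X2
    (fun k => match k with Mode1 => Psi1 | Mode2 => Psi2 end).
Proof.
move=> [p [M [L [e1 e2]]]].
(* Reduction modulo [R2] changes neither the form nor its derivative along the second mode, so both
   modes are treated with [Psi1]. *)
have eq2 v t : in_beh R2 v -> qdf Psi2 v t = qdf Psi1 v t.
  by move=> bv; rewrite e1 e2 !qdf_bilin; apply: eq_bigr => r _; rewrite !beh_rmod.
have eq2' v t : in_beh R2 v -> qdf (mul_zpe Psi2) v t = qdf (mul_zpe Psi1) v t.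
  move=> bv; rewrite e1 e2 !mul_zpe_bilin !qdfD !qdf_bilin.
  by congr (_ + _); apply: eq_bigr => r _; rewrite beh_rmod ?beh_rmodX.
have ge1 v t : 0 <= qdf Psi1 v t by rewrite qdf_state pK.
have sos0 v t : \sum_r diffop Q v r t ^+ 2 = 0 -> forall r, diffop Q v r t = 0.
  move=> s0 r; apply/eqP; rewrite -sqrf_eq0; apply/eqP.
  by apply: (psumr_eq0P _ s0) => // i _; rewrite sqr_ge0.
have dis1 v t : in_beh R1 v -> qdf (mul_zpe Psi1) v t = - \sum_r diffop Q v r t ^+ 2.
  by move=> [_ bv]; apply: qdf_dissipation; left.
have dis2 v t : in_beh R2 v -> qdf (mul_zpe Psi2) v t = - \sum_r diffop Q v r t ^+ 2.
  by move=> bv; rewrite eq2' //; case: bv => _ bv; apply: qdf_dissipation; right.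
have le0 v t : - \sum_r diffop Q v r t ^+ 2 <= 0.
  by rewrite oppr_le0 sumr_ge0 // => r _; rewrite sqr_ge0.
split; [|split].
- by case=> v bv t; rewrite ?eq2.
- case=> v bv; split=> [t|z].
  + by rewrite dis1.
  + apply: (beh_eq0 d1 bv _ rk) => i t; apply: sos0.
    by apply/eqP; rewrite -oppr_eq0 -dis1 // z.
  + by rewrite dis2.
  + apply: (beh_eq0 d2 bv _ (rank_second_mode h2 spec rk)) => i t; apply: sos0.
    by apply/eqP; rewrite -oppr_eq0 -dis2 // z.
move=> s w [_ [_ glueP]] t k l vm vp sp; have gl := glueP _ _ _ _ _ sp.
case: sp => sw [stl [e epos [stk [bm [bp _]]]]].
(* A switch requires a different value arbitrarily close on the left, where the signal is constantly
   [k]. *)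
have kl : k <> l.
  by move=> kl; have [u [u1 [u2]]] := sw e epos; apply; rewrite stk // stl.
case: k l kl bm bp gl {stl stk} => [] [] //= _ bm bp gl.
  (* From mode 1 to mode 2: [X2] is continuous, and the second mode carries the state
     [(a, Pi a)]. *)
  rewrite eq2 // !qdf_state (state_second_mode _ bp) [state X1 vm t]state_col.
  have -> : state X2 vp t = state X2 vm t by apply/matrixP=> i j; rewrite !mxE gl.
  exact: form_split.
(* From mode 2 to mode 1: the gluing condition transfers the full state [(a, Pi a)], so the form
   does not change. *)
rewrite eq2 // !qdf_state.
suff -> : state X1 vp t = state X1 vm t by [].
rewrite (state_second_mode _ bm) -state_cst -state_col.
by apply/matrixP=> i j; rewrite !mxE gl.
Qed.
End Switched.
End RealSystems.

Theorem theorem4 (R : realType) (n n2 m : nat)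
  (R1 R2 : 'M[{poly R}]_n)
  (X2 : 'M[{poly R}]_(n2, n)) (X1' : 'M[{poly R}]_(m, n)) (Pi : 'M[R]_(m, n2)) :
  (* standard SLDS data *)
  \det R1 != 0 -> \det R2 != 0 ->
  sp_right R2 R1 ->
  n2 = (size (\det R2)).-1 ->
  (n2 + m)%N = (size (\det R1)).-1 ->
  state_basis R2 X2 ->
  state_basis R1 (col_mx X2 X1') ->
  rmod R2 X1' = map_mx polyC Pi *m X2 ->
  (* hypotheses of the theorem *)
  hurwitz R1 -> hurwitz R2 ->
  strictly_positive_real (R2 *m \adj R1) (\det R1) ->
  let Phi := bilin R1 R2 + bilin R2 R1 in
  let spec_fact := fun q (Q : 'M[{poly R}]_(q, n)) =>
    diag_sub Phi = diag_sub (bilin Q Q) /\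
    (forall lam : R[i], \rank (col_mx (evalCmx R1 lam) (evalCmx Q lam)) = n) /\
    sp_right Q R1 in
  let Pm := fun k => match k with Mode1 => R1 | Mode2 => R2 end in
  (exists q (Q : 'M[{poly R}]_(q, n)), spec_fact q Q) /\
  (forall q (Q : 'M[{poly R}]_(q, n)), spec_fact q Q ->
     exists Psi1 : 'M[{poly {poly R}}]_n,
       mul_zpe Psi1 = Phi - bilin Q Q /\
       r_canonical R1 Psi1 /\
       (forall Psi2, qdf_mod R2 Psi1 Psi2 ->
          multiple_lyapunov Pm
            (col_mx X2 (map_mx polyC Pi *m X2)) (col_mx X2 X1') X2 X2
            (fun k => match k with Mode1 => Psi1 | Mode2 => Psi2 end))).
Proof.
move=> d1 d2 s21 e2 e1 b2 b1 eX h1 h2 spr Phi spec_fact Pm.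
split.
  have [q [Q [spec rk]]] := exists_real_factor h1 spr.
  exists q, Q; split; first by rewrite /Phi diag_subD !diag_sub_bilin.
  by split => //; apply: sp_right_factor spec.
move=> q Q [spec [rk sQ]].
have {}spec : rpara R1 *m R2 + rpara R2 *m R1 = rpara Q *m Q.
  by move: spec; rewrite /Phi diag_subD !diag_sub_bilin.
have [K [sK pK zpe cross]] := storage_matrix d1 d2 s21 e2 e1 b2 b1 eX h1 sQ spec.
(* The witness is the storage form [X1^T K X1]; both of its factors are strictly proper over [R1],
   so reduction modulo [R1] fixes them. *)
exists (bilin (col_mx X2 X1') (map_mx polyC K *m col_mx X2 X1')); split=> //; split.
  exists (n2 + m)%N, (col_mx X2 X1'), (map_mx polyC K *m col_mx X2 X1'); split=> //.
  have s1 := basis_sp b1.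
  by rewrite !rmod_id //; apply: sp_right_cst.
exact: (lyapunov_switched d1 d2 h2 eX spec rk sK pK zpe cross).
Qed.
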